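(* Let $\{x^k\}_{k\in\mathbb{N}}$ be an (infinite) sequence generated by Algorithm RiVMPL (described in the context) and assume that it is bounded. Then the set $\Omega(x^0)$ of cluster points of $\{x^k\}_{k\in\mathbb{N}}$ is nonempty, and every $x^*\in\Omega(x^0)$ is a stationary point of the problem $\min_{x\in\mathcal{M}}\Theta(x)$, i.e., $x^*\in\mathcal{M}$ and $0\in\nabla f(x^* )+\nabla F(x^* )\partial\vartheta(F(x^* ))+N_{x^*}\mathcal{M}$.
   Context: Setting. $\mathbb{X},\mathbb{Z}$ are finite-dimensional real inner product spaces with induced norms $\|\cdot\|$; $\mathcal{M}\subset\mathbb{X}$ is a $\mathcal{C}^2$-smooth embedded closed submanifold with tangent spaces $T_x\mathcal{M}$ and normal spaces $N_x\mathcal{M}$. The problem is $\min_{x\in\mathcal{M}}\Theta(x):=f(x)+\vartheta(F(x))$ under the standing assumptions: (i) $f:\mathbb{X}\to(-\infty,\infty]$ is proper, lower semicontinuous, and $\mathcal{C}^{1,1}$ (differentiable with locally Lipschitz gradient) on an open convex set $\mathcal{O}\supset\mathcal{M}$; (ii) $\vartheta:\mathbb{Z}\to\mathbb{R}$ is convex with a closed-form proximal mapping; (iii) $F:\mathbb{X}\to\mathbb{Z}$ is $\mathcal{C}^{1,1}$ on $\mathcal{O}$ (differentiable with locally Lipschitz derivative); (iv) $\inf_{x\in\mathcal{M}}\Theta(x)>-\infty$. $F'(x)$ is the differential, $\nabla F(x)$ its adjoint, and $\ell_F(x;z):=F(z)+F'(z)(x-z)$. $\mathcal{I}$ is the identity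 and $\|v\|_{\mathcal{Q}}^2:=\langle v,\mathcal{Q}v\rangle$. A retraction is a smooth map $R:T\mathcal{M}\to\mathcal{M}$ ($T\mathcal{M}$ the tangent bundle) such that $R_x:=R(x,\cdot):T_x\mathcal{M}\to\mathcal{M}$ satisfies $R_x(0)=x$ and $R_x'(0)=\mathcal{I}$ for every $x\in\mathcal{M}$. Algorithm RiVMPL. Input: a retraction $R$, parameters $0<\alpha_{\min}\le\alpha_{\max}$, $\mu_{\max}>0$, $\overline{\alpha}>0$, $\overline{\gamma}>0$, $\sigma>1$, and $x^0\in\mathcal{M}$. For $k=0,1,2,\ldots$: choose $\alpha_{k,0}\in[\alpha_{\min},\alpha_{\max}]$ and $\mu_k\in(0,\mu_{\max}]$. Inner loop, $j=0,1,2,\ldots$: choose a self-adjoint linear operator $\mathcal{Q}_{k,j}:\mathbb{X}\to\mathbb{X}$ with $\alpha_{k,j}\mathcal{I}\preceq\mathcal{Q}_{k,j}\preceq(\overline{\alpha}+\alpha_{k,j})\mathcal{I}$; let $$\Theta_{k,j}(v):=\langle\nabla f(x^k),v\rangle+\tfrac12\|v\|^2_{\mathcal{Q}_{k,j}}+\vartheta(\ell_F(x^k+v;x^k))+f(x^k)$$ and let $\overline{v}^{k,j}$ be its unique minimizer over $v\in T_{x^k}\mathcal{M}$; find $(v^{k,j},\Theta^{\rm LB}_{k,j})\in T_{x^k}\mathcal{M}\times(-\infty,\Theta_{k,j}(\overline{v}^{k,j})]$ with $\Theta_{k,j}(v^{k,j})\le\Theta_{k,j}(0)$ and $\Theta_{k,j}(v^{k,j})-\Theta^{\rm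 LB}_{k,j}\le\frac{\mu_k}{2}\|v^{k,j}\|^2$. If $\Theta(R_{x^k}(v^{k,j}))\le\Theta_{k,j}(v^{k,j})-\frac{\overline{\gamma}}{2}\|v^{k,j}\|^2$ or $\|v^{k,j}\|=0$, leave the inner loop; else set $\alpha_{k,j+1}:=\sigma\alpha_{k,j}$ and continue it. After the inner loop: if $\|v^{k,j}\|=0$, stop; else set $j_k:=j$, $v^k:=v^{k,j_k}$, $\overline{v}^k:=\overline{v}^{k,j_k}$, $\mathcal{Q}_k:=\mathcal{Q}_{k,j_k}$, $\Theta_k:=\Theta_{k,j_k}$, $x^{k+1}:=R_{x^k}(v^k)$. *)

(* Defs.v *)
From HB Require Import structures.
From mathcomp Require Import all_boot all_order all_algebra.
From mathcomp Require Import all_classical all_reals all_analysis.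
Set Implicit Arguments.
Unset Strict Implicit.
Unset Printing Implicit Defensive.
Import Order.TTheory GRing.Theory Num.Theory.
Import numFieldNormedType.Exports.
Local Open Scope classical_set_scope.
Local Open Scope ring_scope.

(* Finite-dimensional real inner product spaces. The norm (hence the topology
   and the differential) of the underlying normed module is forced to be the
   one induced by the inner product. *)
HB.mixin Record isEuclidean (R : realType) X
    & NormedModule R X & Vector R X := {
  inner : X -> X -> R ;
  innerC : forall u v, inner u v = inner v u ;
  innerDl : forall u v w, inner (u + v) w = inner u w + inner v w ;
  innerZl : forall (a : R) u v, inner (a *: u) v = a * inner u v ;
  sqr_norm_inner : forall u, `|u| ^+ 2 = inner u u
}.

#[short(type="euclideanType")]
HB.structure Definition Euclidean (R : realType) :=
  { X of isEuclidean R X & NormedModule R X & Vector R X }.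

Section Regularity.
Context {R : realType}.
Implicit Types V W : normedModType R.

(* In finite dimension, continuity of [y |-> 'd g y v] for every direction [v]
   is continuity of the differential in operator norm. *)
Definition C1_on V W (U : set V) (g : V -> W) : Prop :=
  forall x, U x ->
    differentiable g x /\ forall v, {for x, continuous (fun y => 'd g y v)}.

Definition C2_on V W (U : set V) (g : V -> W) : Prop :=
  (forall x, U x -> differentiable g x) /\
  forall v, C1_on U (fun y => 'd g y v).

(* [C^1] maps on an arbitrary subset [S]: local [C^1] extensions to open sets
   of the ambient space. *)
Definition C1_on_subset V W (S : set V) (g : V -> W) : Prop :=
  forall p, S p -> exists (U : set V) (G : V -> W),
    [/\ open U, U p, C1_on U G & forall q, S q -> U q -> G q = g q].

(* The library's [locally lipschitz] notation ranges over neighbourhoods of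
   pairs of points of [O] and is not used here. *)
Definition locally_lipschitz_on V W (O : set V) (g : V -> W) : Prop :=
  forall x, O x -> exists2 U, nbhs x U & [lipschitz g y | y in U].

(* Lipschitz continuity of the differential in operator norm. *)
Definition diff_locally_lipschitz_on V W (O : set V) (g : V -> W) : Prop :=
  forall x, O x -> exists2 U, nbhs x U & exists L : R,
    forall y z, U y -> U z ->
      forall v, `|'d g y v - 'd g z v| <= L * `|y - z| * `|v|.

End Regularity.

Section Euclidean_definitions.
Context {R : realType}.
Implicit Types X Z : euclideanType R.

(* In this finite-dimensional setting the sets below are singletons when [g] is
   differentiable at [x], resp. when [A] is linear (Riesz representation). *)
Definition gradient X (g : X -> R) (x : X) : X :=
  get [set u : X | forall v, inner u v = 'd g x v].

Definition adjoint X Z (A : X -> Z) (z : Z) : X :=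
  get [set u : X | forall v, inner u v = inner z (A v)].

Definition self_adjoint X (Q : X -> X) : Prop :=
  forall u v, inner (Q u) v = inner u (Q v).

Definition loewner_le X (A B : X -> X) : Prop :=
  forall v, inner v (A v) <= inner v (B v).

Definition subdifferential Z (theta : Z -> R) (z : Z) : set Z :=
  [set zeta | forall w, theta z + inner zeta (w - z) <= theta w].

Definition C2_diffeomorphism X (U V : set X) (phi psi : X -> X) : Prop :=
  [/\ open U, open V, C2_on U phi & C2_on V psi] /\
  [/\ set_fun U V phi, set_fun V U psi,
      {in U, cancel phi psi} & {in V, cancel psi phi}].

(* Slice charts: near each of its points, [M] is mapped by a [C^2]
   diffeomorphism of the ambient space onto an open piece of a [d]-dimensional
   linear subspace. *)
Definition C2_submanifold X (d : nat) (M : set X) : Prop :=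
  forall x, M x -> exists (U V : set X) (phi psi : X -> X) (E : {vspace X}),
    [/\ U x, C2_diffeomorphism U V phi psi, (\dim E = d)%N
      & M `&` U = U `&` phi @^-1` [set` E]].

Definition tangent X (M : set X) (x : X) : set X :=
  [set v | exists (e : R) (c : R -> X),
    [/\ 0 < e, C1_on (ball (0 : R) e) c, forall t, ball (0 : R) e t -> M (c t),
        c 0 = x & is_derive (0 : R) (1 : R) c v]].

Definition normal X (M : set X) (x : X) : set X :=
  [set n | forall v, tangent M x v -> inner n v = 0].

Definition tangent_bundle X (M : set X) : set (X * X) :=
  [set p | M p.1 /\ tangent M p.1 p.2].

(* [Rt x v] is R_x(v); its values off the tangent bundle are irrelevant. The
   tangent bundle of a [C^2] submanifold is a [C^1] submanifold, so that smooth
   means [C^1] here. The last clause is the Frechet derivative at 0 of the map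
   R_x defined on the tangent space at [x]. *)
Definition retraction X (M : set X) (Rt : X -> X -> X) : Prop :=
  [/\ forall x v, M x -> tangent M x v -> M (Rt x v),
      C1_on_subset (tangent_bundle M) (fun p => Rt p.1 p.2),
      forall x, M x -> Rt x 0 = x
    & forall x, M x -> forall eps : R, 0 < eps ->
        \forall v \near (0 : X), tangent M x v ->
          `|Rt x v - Rt x 0 - v| <= eps * `|v| ].

Definition objective X Z (f : X -> \bar R) (theta : Z -> R) (F : X -> Z)
  (x : X) : \bar R := (f x + (theta (F x))%:E)%E.

(* [f] is extended-valued and finite on [O]; [fine \o f] is its real-valued
   version there. *)
Definition standing_assumptions X Z (d : nat) (M O : set X)
    (f : X -> \bar R) (theta : Z -> R) (F : X -> Z) : Prop :=
  [/\ C2_submanifold d M /\ closed M, open O, convex_set O & M `<=` O] /\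
  [/\ [/\ (forall x, f x != -oo%E) /\ (exists x, f x != +oo%E),
          lower_semicontinuous f,
          forall x, O x -> f x \is a fin_num,
          forall x, O x -> differentiable (fine \o f) x
        & locally_lipschitz_on O (gradient (fine \o f))],
      convex_function [set: Z] theta,
      (forall x, O x -> differentiable F x) /\ diff_locally_lipschitz_on O F
    & (-oo < ereal_inf (objective f theta F @` M))%E].

Definition stationary X Z (M : set X) (f : X -> \bar R) (theta : Z -> R)
    (F : X -> Z) (x : X) : Prop :=
  M x /\ exists zeta n, [/\ subdifferential theta (F x) zeta, normal M x n
    & 0 = gradient (fine \o f) x + adjoint ('d F x) zeta + n].

(* l_F(y; x) *)
Definition linearization X Z (F : X -> Z) (y x : X) : Z := F x + 'd F x (y - x).

(* Theta_{k,j}(v) for x = x^k and Q = Q_{k,j} *)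
Definition model X Z (f : X -> \bar R) (theta : Z -> R) (F : X -> Z)
    (x : X) (Q : X -> X) (v : X) : R :=
  inner (gradient (fine \o f) x) v + 2^-1 * inner v (Q v)
  + theta (linearization F (x + v) x) + fine (f x).

Record rivmpl_params := RivmplParams {
  alpha_min : R ; alpha_max : R ; mu_max : R ;
  alpha_bar : R ; gamma_bar : R ; sigma : R }.

Definition rivmpl_params_ok (p : rivmpl_params) : Prop :=
  [/\ 0 < alpha_min p <= alpha_max p, 0 < mu_max p, 0 < alpha_bar p,
      0 < gamma_bar p & 1 < sigma p].

(* Quantities produced along a run; [t_stop k] is j_k, and the doubly indexed
   data at (k, j) are meaningful for j <= j_k only. *)
Record rivmpl_trace X := RivmplTrace {
  t_alpha : nat -> nat -> R ;
  t_mu : nat -> R ;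
  t_Q : nat -> nat -> {linear X -> X} ;
  t_v : nat -> nat -> X ;
  t_vbar : nat -> nat -> X ;
  t_LB : nat -> nat -> R ;
  t_stop : nat -> nat }.

(* One pass of the inner loop at x = x^k, up to the acceptance test. *)
Definition inner_iteration X Z (M : set X) (f : X -> \bar R) (theta : Z -> R)
    (F : X -> Z) (p : rivmpl_params) (x : X) (mu alpha : R)
    (Q : {linear X -> X}) (v vbar : X) (LB : R) : Prop :=
  let Th := model f theta F x Q in
  [/\ [/\ self_adjoint Q,
          loewner_le (fun u => alpha *: u) Q
        & loewner_le Q (fun u => (alpha_bar p + alpha) *: u)],
      tangent M x vbar /\ (forall w, tangent M x w -> Th vbar <= Th w),
      tangent M x v /\ LB <= Th vbar,
      Th v <= Th 0
    & Th v - LB <= mu / 2 * `|v| ^+ 2].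

Definition accepted X Z (f : X -> \bar R) (theta : Z -> R) (F : X -> Z)
    (p : rivmpl_params) (Rt : X -> X -> X) (x : X) (Q : X -> X) (v : X) : Prop :=
  (objective f theta F (Rt x v)
     <= (model f theta F x Q v - gamma_bar p / 2 * `|v| ^+ 2)%:E)%E
  \/ `|v| = 0.

(* A run that never stops: every inner loop ends, with a nonzero v^k. *)
Definition rivmpl_run X Z (M : set X) (f : X -> \bar R) (theta : Z -> R)
    (F : X -> Z) (p : rivmpl_params) (Rt : X -> X -> X) (x : nat -> X)
    (t : rivmpl_trace X) : Prop :=
  M (x 0%N) /\
  forall k, let J := t_stop t k in
  [/\ alpha_min p <= t_alpha t k 0%N <= alpha_max p /\ 0 < t_mu t k <= mu_max p,
      forall j, (j <= J)%N ->
        inner_iteration M f theta F p (x k) (t_mu t k) (t_alpha t k j)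
          (t_Q t k j) (t_v t k j) (t_vbar t k j) (t_LB t k j),
      forall j, (j < J)%N ->
        ~ accepted f theta F p Rt (x k) (t_Q t k j) (t_v t k j) /\
        t_alpha t k j.+1 = sigma p * t_alpha t k j,
      accepted f theta F p Rt (x k) (t_Q t k J) (t_v t k J)
    & `|t_v t k J| <> 0 /\ x k.+1 = Rt (x k) (t_v t k J)].

Definition rivmpl_generated X Z (M : set X) (f : X -> \bar R) (theta : Z -> R)
    (F : X -> Z) (p : rivmpl_params) (Rt : X -> X -> X) (x : nat -> X) : Prop :=
  exists t, rivmpl_run M f theta F p Rt x t.

End Euclidean_definitions.

Arguments rivmpl_params : clear implicits.

(* Main.v *)
(* Along a run the objective decreases by at least gamma/2 |v^k|^2, so v^k tends
   to 0. Let xs be a cluster point. The retraction is only C^1, so that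
   R_y(v) = y + v + o(|v|) without a quadratic remainder, and the accepted
   alpha_k may be unbounded near xs. But if a trial step v at y is rejected, then
   (alpha - gamma)/2 |v|^2 <= o(|v|), hence alpha |v| tends to 0 along rejected
   steps with alpha tending to infinity. So in all cases there are trial steps v
   at iterates y close to xs, accepted or rejected, with |v| and alpha |v|
   arbitrarily small. Comparing the model at v with the model at s u, for u
   tangent at y and s proportional to |v|, the quadratic terms and the
   inexactness mu/2 |v|^2 disappear in the limit and leave
     <grad f(xs), w> + theta(F(xs) + F'(xs) w) - theta(F(xs)) >= 0
   for every w tangent at xs. A Hahn-Banach argument turns this convex inequality
   into the multiplier of the stationarity condition. *)
Require Import Defs.
From HB Require Import structures.
From mathcomp Require Import all_boot all_order all_algebra.
From mathcomp Require Import ring lra.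
From mathcomp Require Import all_classical all_reals all_analysis.
Set Implicit Arguments.
Unset Strict Implicit.
Unset Printing Implicit Defensive.
Import Order.TTheory GRing.Theory Num.Theory.
Import numFieldNormedType.Exports.
Local Open Scope classical_set_scope.
Local Open Scope ring_scope.

(** * Inner products *)

Section InnerProduct.
Context {R : realType} {X : euclideanType R}.
Implicit Types (u v w x : X) (s : seq X).

Lemma innerDr u v w : inner u (v + w) = inner u v + inner u w.
Proof. by rewrite innerC innerDl !(innerC u). Qed.

Lemma innerZr (a : R) u v : inner u (a *: v) = a * inner u v.
Proof. by rewrite innerC innerZl (innerC u). Qed.

Lemma inner0l v : inner 0 v = 0.
Proof. by rewrite -(scale0r (0 : X)) innerZl mul0r. Qed.

Lemma inner0r v : inner v 0 = 0.
Proof. by rewrite innerC inner0l. Qed.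

Lemma innerNl u v : inner (- u) v = - inner u v.
Proof. by rewrite -scaleN1r innerZl mulN1r. Qed.

Lemma innerBl u v w : inner (u - v) w = inner u w - inner v w.
Proof. by rewrite innerDl innerNl. Qed.

Lemma innerBr u v w : inner u (v - w) = inner u v - inner u w.
Proof. by rewrite innerC innerBl !(innerC u). Qed.

Lemma inner_suml (I : Type) (r : seq I) (c : I -> X) w :
  inner (\sum_(i <- r) c i) w = \sum_(i <- r) inner (c i) w.
Proof.
elim: r => [|i r IH]; first by rewrite !big_nil inner0l.
by rewrite !big_cons innerDl IH.
Qed.

Lemma inner_sumr (I : Type) (r : seq I) (c : I -> X) w :
  inner w (\sum_(i <- r) c i) = \sum_(i <- r) inner w (c i).
Proof. by rewrite innerC inner_suml; apply: eq_bigr => i _; rewrite innerC. Qed.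

Lemma inner_ge0 u : 0 <= inner u u.
Proof. by rewrite -sqr_norm_inner exprn_ge0. Qed.

Lemma inner_eq0 u : (inner u u == 0) = (u == 0).
Proof. by rewrite -sqr_norm_inner sqrf_eq0 normr_eq0. Qed.

Lemma cauchy_schwarz u v : `|inner u v| <= `|u| * `|v|.
Proof.
rewrite -(@ler_pXn2r _ 2) ?nnegrE ?mulr_ge0// exprMn !sqr_norm_inner.
have -> : `|inner u v| ^+ 2 = inner u v ^+ 2 by rewrite real_normK ?num_real.
have [->|v0] := eqVneq v 0; first by rewrite !inner0r expr0n /= mulr0.
have vv : 0 < inner v v by rewrite lt_neqAle inner_ge0 eq_sym inner_eq0 v0.
have := inner_ge0 (inner v v *: u - inner u v *: v).
rewrite !(innerBl, innerBr, innerZl, innerZr) (innerC v u).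
set a := inner u u; set b := inner u v; set c := inner v v in vv * => h.
have : 0 <= c * (a * c - b ^+ 2) by nra.
by rewrite pmulr_rge0// subr_ge0.
Qed.

Lemma inner_le u v : inner u v <= `|u| * `|v|.
Proof. exact: le_trans (ler_norm _) (cauchy_schwarz u v). Qed.

Definition frame_sum s x : X := \sum_(e <- s) inner x e *: e.

(** Stands in for an orthonormal basis: the reconstruction identity alone yields Riesz
    representation and bounded coordinates. *)
Definition parseval_frame s := forall x, frame_sum s x = x.

Lemma frame_sumD s x y : frame_sum s (x + y) = frame_sum s x + frame_sum s y.
Proof.
by rewrite -big_split; apply: eq_bigr => e _; rewrite innerDl scalerDl.
Qed.

Lemma frame_sumZ s a x : frame_sum s (a *: x) = a *: frame_sum s x.
Proof.
by rewrite /frame_sum scaler_sumr; apply: eq_bigr => e _; rewrite innerZl scalerA.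
Qed.

Lemma frame_sum0 s : frame_sum s 0 = 0.
Proof. by rewrite -[in LHS](scale0r (0 : X)) frame_sumZ scale0r. Qed.

Lemma frame_sumB s x y : frame_sum s (x - y) = frame_sum s x - frame_sum s y.
Proof. by rewrite frame_sumD -scaleN1r frame_sumZ scaleN1r. Qed.

Lemma frame_sum_sym s x y : inner (frame_sum s x) y = inner x (frame_sum s y).
Proof.
rewrite inner_suml inner_sumr; apply: eq_bigr => e _.
by rewrite innerZl innerZr (innerC e) mulrC.
Qed.

(** The first clause is the invariant: it makes the symmetric map [frame_sum s] idempotent, hence an
    orthogonal projection. The residual of a new vector is killed by it, and the normalized residual
    extends [s]. *)
Lemma gram_schmidt (t : seq X) : exists2 s,
  {in s, forall e, frame_sum s e = e} & {in t, forall a, frame_sum s a = a}.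
Proof.
elim: t => [|a t [s hs ht]]; first by exists [::].
pose a' := a - frame_sum s a.
have idem x : frame_sum s (frame_sum s x) = frame_sum s x.
  suff idr r : {subset r <= s} -> frame_sum s (\sum_(e <- r) inner x e *: e)
      = \sum_(e <- r) inner x e *: e by exact: idr.
  elim: r => [|e r IH] rs.
    by rewrite big_nil frame_sum0.
  rewrite big_cons frame_sumD frame_sumZ hs ?rs ?mem_head// IH// => z zr.
  by rewrite rs// in_cons zr orbT.
have Ta' : frame_sum s a' = 0 by rewrite frame_sumB idem subrr.
have [a'0|a'0] := eqVneq a' 0.
  exists s => // b; rewrite in_cons => /orP[/eqP ->|]; last exact: ht.
  by apply/eqP; rewrite eq_sym -subr_eq0; apply/eqP.
pose e0 := `|a'|^-1 *: a'.
have Te0 : frame_sum s e0 = 0 by rewrite frame_sumZ Ta' scaler0.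
have na' : `|a'| != 0 by rewrite normr_eq0.
have ee0 : inner e0 e0 = 1.
  by rewrite innerZl innerZr -sqr_norm_inner mulrA expr2; field.
have perp b : frame_sum s b = b -> inner b e0 = 0.
  by move=> <-; rewrite frame_sum_sym Te0 inner0r.
have consE b : frame_sum (e0 :: s) b = inner b e0 *: e0 + frame_sum s b.
  by rewrite /frame_sum big_cons.
have Te0' : frame_sum (e0 :: s) e0 = e0 by rewrite consE Te0 ee0 scale1r addr0.
have fix_s b : frame_sum s b = b -> frame_sum (e0 :: s) b = b.
  by move=> hb; rewrite consE perp// scale0r add0r.
exists (e0 :: s) => b; rewrite in_cons => /orP[/eqP->|bs] //.
- exact: fix_s (hs _ bs).
- have -> : a = frame_sum s a + `|a'| *: e0.
    by rewrite /e0 scalerA mulfV// scale1r addrC subrK.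
  by rewrite frame_sumD frame_sumZ Te0' fix_s.
- exact: fix_s (ht _ bs).
Qed.

Lemma exists_parseval_frame : exists s, parseval_frame s.
Proof.
have [s _ hs] := gram_schmidt (vbasis {:X}); exists s => x.
have -> := coord_vbasis (memvf x).
have Tsum (I : Type) (r : seq I) (c : I -> X) :
    (forall i, frame_sum s (c i) = c i) ->
    frame_sum s (\sum_(i <- r) c i) = \sum_(i <- r) c i.
  move=> hc; elim: r => [|i r IH].
    by rewrite big_nil frame_sum0.
  by rewrite big_cons frame_sumD hc IH.
apply: Tsum => i; rewrite frame_sumZ hs//.
by rewrite mem_nth// size_tuple.
Qed.

Lemma riesz (l : X -> R) : (forall u v, l (u + v) = l u + l v) ->
  (forall a u, l (a *: u) = a * l u) -> exists u, forall v, inner u v = l v.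
Proof.
move=> lD lZ; have [s hs] := exists_parseval_frame.
exists (\sum_(e <- s) l e *: e) => v.
rewrite -[in RHS](hs v) inner_suml /frame_sum; elim: (s) => [|e r IH].
  by rewrite !big_nil -(scale0r (0 : X)) lZ mul0r.
by rewrite !big_cons lD lZ innerZl IH mulrC innerC.
Qed.

End InnerProduct.

Section Riesz.
Context {R : realType} {X Z : euclideanType R}.

(** [gradient] is a choice by [get]; Riesz representation shows that the set chosen from is
    inhabited. *)
Lemma inner_gradient (g : X -> R) x v : inner (gradient g x) v = 'd g x v.
Proof.
have [||u hu] := @riesz R X ('d g x).
- by move=> ? ?; rewrite linearD.
- by move=> ? ?; rewrite linearZ.
by have := @xgetPex _ point [set u | forall v, inner u v = 'd g x v]
  (ex_intro _ u hu); apply.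
Qed.

Lemma inner_adjoint (A : {linear X -> Z}) z v :
  inner (adjoint A z) v = inner z (A v).
Proof.
have [||u hu] := @riesz R X (fun v => inner z (A v)).
- by move=> ? ?; rewrite linearD innerDr.
- by move=> ? ?; rewrite linearZ innerZr.
by have := @xgetPex _ point [set u | forall v, inner u v = inner z (A v)]
  (ex_intro _ u hu); apply.
Qed.

End Riesz.

HB.instance Definition _ (R : realType) (X : euclideanType R) (u : X) :=
  @GRing.isLinear.Build R X R *%R (inner u) (fun a v w =>
    etrans (innerDr u (a *: v) w) (congr1 (+%R^~ _) (innerZr a u v))).

Lemma inner_continuous (R : realType) (X : euclideanType R) (u : X) :
  continuous (inner u).
Proof.
apply: (@bounded_linear_continuous _ _ _ (inner u)).
apply/linear_boundedP; exists `|u|; split; first exact: num_real.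
move=> r ur v; apply: le_trans (cauchy_schwarz u v) _.
by rewrite ler_wpM2r// ltW.
Qed.

(** Frame coefficients of a bounded sequence lie in a compact box of row vectors, whose continuous
    image in [X] is compact and contains every term. *)
Lemma bounded_cluster (R : realType) (X : euclideanType R) (x : nat -> X) :
  bounded_set (range x) -> cluster (x @ \oo) !=set0.
Proof.
have ne : ProperFilter (globally (range x)).
  by apply: globally_properfilter; exists 0%N.
move=> /ex_bound[K hK]; have [s hs] := @exists_parseval_frame R X.
pose e (i : 'I_(size s)) := tnth (in_tuple s) i.
pose phi (c : 'rV[R]_(size s)) : X := \sum_i c ord0 i *: e i.
have cphi : continuous phi.
  rewrite /phi; apply: continuous_big => [|i _ c]; first exact: add_continuous.
  apply: cvgZr_tmp; first exact: (@nbhs_filter _ c).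
  exact: (@coord_continuous R _ _ ord0 i c).
have cA := @rV_compact R _ (fun i => `[- (K * `|e i|), K * `|e i|]%classic)
  (fun i => @segment_compact R (- (K * `|e i|)) (K * `|e i|)).
have := continuous_compact (continuous_subspaceT cphi) cA.
set A := (X in phi @` X) => cphiA.
have xA : (x @ \oo) (phi @` A).
  exists 0%N => // k _ /=; exists (\row_i inner (x k) (e i)).
    move=> i /=; rewrite mxE in_itv/= -ler_norml.
    apply: le_trans (cauchy_schwarz _ _) _; rewrite ler_wpM2r//.
    by apply: hK; exists k.
  rewrite -[RHS]hs /phi /frame_sum (big_tnth _ _ s).
  by apply: eq_bigr => i _; rewrite mxE.
have [p [_ hp]] := cphiA (x @ \oo) _ xA.
by exists p.
Qed.

Lemma clusterP (R : realType) (X : normedModType R) (x : nat -> X) xs :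
  cluster (x @ \oo) xs ->
  forall (N : nat) (e : R), 0 < e -> exists2 k, (N <= k)%N & `|xs - x k| < e.
Proof.
move=> hc N e e0.
have h1 : (x @ \oo) (x @` [set k | (N <= k)%N]).
  by exists N => // k /= Nk; exists k.
have h2 : nbhs xs [set y | `|xs - y| < e].
  by apply/nbhs_normP; exists e.
by have [_ [[k Nk <-] ke]] := hc _ _ h1 h2; exists k.
Qed.

(** * Strict differentiability *)

Section Calculus.
Context {R : realType}.
Implicit Types V W : normedModType R.

Lemma is_derive_line V W (g : V -> W) a h (t : R) :
  differentiable g (a + t *: h) ->
  is_derive t 1 (fun s : R => g (a + s *: h)) ('d g (a + t *: h) h).
Proof.
move=> dg.
have dl : is_diff t (fun s : R => a + s *: h) (fun s : R => s *: h).
  by apply: is_diff_eq; rewrite add0r.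
have /= dc := @is_diff_comp _ _ _ _ (fun s : R => a + s *: h)
  (fun s : R => s *: h) g ('d g (a + t *: h)) t dl (differentiableP dg).
apply: DeriveDef; first exact/diff_derivable/ex_diff.
by rewrite deriveE ?diff_val /= ?scale1r//; apply: ex_diff.
Qed.

(** Norming functionals reduce vector-valued mean value estimates to the real mean value theorem. *)
Definition normed_by_dual W := forall w : W, exists l : {linear W -> R},
  [/\ continuous l, l w = `|w| & forall v, l v <= `|v|].

Lemma mean_value_le V W (g : V -> W) y h c e : normed_by_dual W ->
  (forall t : R, 0 <= t <= 1 ->
    differentiable g (y + t *: h) /\ `|'d g (y + t *: h) h - c| <= e) ->
  `|g (y + h) - g y - c| <= e.
Proof.
move=> dualW hg; have [l [cl lw ln]] := dualW (g (y + h) - g y - c).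
pose phi (t : R) := l (g (y + t *: h)).
have dphi (t : R) : 0 <= t <= 1 -> is_derive t 1 phi (l ('d g (y + t *: h) h)).
  move=> /hg[dg _]; have := is_derive_line (differentiable_comp dg
    (linear_differentiable (g (y + t *: h)) cl)).
  by rewrite diff_comp//= ?diff_lin//; exact: linear_differentiable.
have [||z] := @MVT R phi (fun t => l ('d g (y + t *: h) h)) 0 1 ltr01.
- by move=> t; rewrite in_itv/= => /andP[t0 t1]; apply: dphi; rewrite !ltW.
- apply: derivable_within_continuous => t; rewrite in_itv/= => /dphi.
  by case.
rewrite in_itv/= => /andP[z0 z1].
rewrite /phi subr0 mulr1 scale1r scale0r addr0 -linearB => eqz.
have [_ hz] := hg z ltac:(by rewrite !ltW).
by rewrite -lw linearB/= eqz -linearB/=; apply: le_trans (ln _) hz.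
Qed.

(** Common ground for the $C^1$ extension of the retraction and the $C^{1,1}$ data [f] and [F]; it
    already gives strict differentiability at [x]. *)
Definition continuously_differentiable V W (g : V -> W) x :=
  forall e : R, 0 < e -> \forall y \near x,
    differentiable g y /\ forall v, `|'d g y v - 'd g x v| <= e * `|v|.

(** Balls are convex, so the whole segment from [y] to [z] stays where ['d g] is close to ['d g x],
    and the mean value estimate applies along it. *)
Lemma strict_differentiability V W (g : V -> W) x : normed_by_dual W ->
  continuously_differentiable g x -> forall e : R, 0 < e ->
  exists2 r : R, 0 < r & forall y z, `|x - y| < r -> `|x - z| < r ->
    `|g z - g y - 'd g x (z - y)| <= e * `|z - y|.
Proof.
move=> dualW cg e e0; have /nbhs_normP[r /= r0 hr] := cg e e0.
exists r => // y z yr zr.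
have {1}-> : z = y + (z - y) by rewrite addrC subrK.
apply: mean_value_le => // t /andP[t0 t1].
have -> : y + t *: (z - y) = (1 - t) *: y + t *: z.
  by rewrite scalerBr scalerBl scale1r addrCA [LHS]addrC.
suff: `|x - ((1 - t) *: y + t *: z)| < r by move=> /hr[].
 have -> : x - ((1 - t) *: y + t *: z)
    = (1 - t) *: (x - y) + t *: (x - z).
  rewrite !scalerBr addrACA -scalerDl subrK scale1r opprD//.
apply: le_lt_trans (ler_normD _ _) _; rewrite !normrZ.
rewrite !ger0_norm ?subr_ge0//.
have [->|tn0] := eqVneq t 0; first by rewrite subr0 mul1r mul0r addr0.
have tp : 0 < t by rewrite lt_neqAle eq_sym tn0.
by nra.
Qed.

Lemma real_normed_by_dual : normed_by_dual R.
Proof.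
move=> w; exists ( *:%R (Num.sg w)); split.
- exact: scaler_continuous.
- by rewrite -[LHS]/(_ * _) -normrEsg.
- move=> v; rewrite -[leLHS]/(_ * _); apply: le_trans (ler_norm _) _; rewrite normrM normr_sg.
  by rewrite ler_piMl//; case: (w == 0).
Qed.

Lemma euclidean_normed_by_dual (X : euclideanType R) : normed_by_dual X.
Proof.
move=> w; have [->|w0] := eqVneq w 0.
  exists (inner (0 : X)); split; first exact: inner_continuous.
    by rewrite /= inner0l normr0.
  by move=> v /=; rewrite inner0l.
have nw : 0 < `|w| by rewrite normr_gt0.
exists (inner (`|w|^-1 *: w)); split; first exact: inner_continuous.
  by rewrite /= innerZl -sqr_norm_inner expr2 mulKf ?gt_eqF.
move=> v /=; apply: le_trans (inner_le _ _) _.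
by rewrite normrZ gtr0_norm ?invr_gt0// mulVf ?gt_eqF// mul1r.
Qed.

(** Frames without an inner product: the retraction is differentiated on [X * X], which carries the
    max norm. The bounds [K i] are positive so that tolerances can be divided by them. *)
Definition finite_frame V := exists (I : finType) (e : I -> V) (c : I -> V -> R)
    (K : I -> R),
  [/\ forall v, v = \sum_i c i v *: e i, forall i, 0 < K i
    & forall i v, `|c i v| <= K i * `|v|].

(** [C1_on] controls the differential one direction at a time. Expanding along a finite frame, with
    the tolerance halved at each frame vector, gives operator-norm continuity. *)
Lemma C1_continuously_differentiable V W (U : set V) (g : V -> W) x :
  finite_frame V -> open U -> U x -> C1_on U g ->
  continuously_differentiable g x.
Proof.
move=> [I [b [c [K [hb K0 hc]]]]] oU Ux cg.
have near_sum (r : seq I) (e : R) : 0 < e -> \forall y \near x, forall v,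
    `|\sum_(u <- r) c u v *: ('d g y (b u) - 'd g x (b u))| <= e * `|v|.
  elim: r e => [e e0|u r IH e e0].
    by apply: nearW => y v; rewrite big_nil normr0 mulr_ge0// ltW.
  have e2 : 0 < e / 2 by rewrite divr_gt0.
  have := IH _ e2; have [_ /(_ (b u))/cvgrPdist_lt/(_ (e / 2 / K u))] := cg x Ux.
  move=> /(_ (divr_gt0 e2 (K0 u))) h1 h2.
  near=> y => v; rewrite big_cons; apply: le_trans (ler_normD _ _) _.
  have -> : e * `|v| = e / 2 * `|v| + e / 2 * `|v| by field.
  apply: lerD; last by move: v; near: y.
  have /ltW : `|'d g x (b u) - 'd g y (b u)| < e / 2 / K u by near: y.
  rewrite distrC normrZ ler_pdivlMr// => h.
  have := hc u v; have := normr_ge0 v; have := normr_ge0 (c u v).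
  have := normr_ge0 ('d g y (b u) - 'd g x (b u)); have := K0 u.
  move: h; set a := `|_ - _|; set q := `|c u v|; set k := K u; set n := `|v|.
  move=> h k0 a0 q0 n0 qk.
  apply: le_trans (ler_wpM2r a0 qk) _.
  rewrite mulrAC [k * a]mulrC; exact: ler_wpM2r.
move=> e e0; near=> y; split.
  have : U y by near: y; exact: open_nbhs_nbhs.
  by move=> /cg[].
have hy := near (near_sum (index_enum I) e e0) y.
move=> v; have lin z : 'd g z v = \sum_u c u v *: 'd g z (b u).
  by rewrite [in LHS](hb v) linear_sum; apply: eq_bigr => u _; rewrite linearZ.
rewrite !lin -sumrB; under eq_bigr do rewrite -scalerBr.
by apply: hy.
Unshelve. all: by end_near. Qed.

Lemma euclidean_finite_frame (X : euclideanType R) : finite_frame X.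
Proof.
have [s hs] := @exists_parseval_frame R X.
pose e (i : 'I_(size s)) := tnth (in_tuple s) i.
exists 'I_(size s), e, (fun i v => inner v (e i)), (fun i => `|e i| + 1); split.
- by move=> v; rewrite -[LHS]hs /frame_sum (big_tnth _ _ s).
- by move=> i; rewrite ltr_wpDl.
- move=> i v; apply: le_trans (cauchy_schwarz _ _) _.
  by rewrite mulrC ler_wpM2r// lerDl.
Qed.

Lemma prod_finite_frame V W :
  finite_frame V -> finite_frame W -> finite_frame (V * W)%type.
Proof.
move=> [I [e [c [K [he K0 hc]]]]] [J [e' [c' [K' [he' K0' hc']]]]].
exists (I + J)%type, (fun i => match i with inl i => (e i, 0) | inr j => (0, e' j) end),
  (fun i v => match i with inl i => c i v.1 | inr j => c' j v.2 end),
  (fun i => match i with inl i => K i | inr j => K' j end); split.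
- move=> [v w]; rewrite big_sumType/=.
  rewrite (_ : \sum_i c i v *: (e i, 0) = (v, 0)).
    rewrite (_ : \sum_i c' i w *: (0, e' i) = (0, w)).
      by rewrite -[RHS]/(v + 0, 0 + w) addr0 add0r.
    rewrite [in RHS](he' w); elim/big_rec2: _ => // i y1 y2 _ ->.
    by congr (_, _); rewrite /= scaler0 addr0.
  rewrite [in RHS](he v); elim/big_rec2: _ => // i y1 y2 _ ->.
  by congr (_, _); rewrite /= scaler0 addr0.
- by case.
- move=> [i|j] [v w] /=.
    apply: le_trans (hc _ _) _; rewrite ler_wpM2l ?(ltW (K0 _))//.
    by rewrite prod_normE/= le_max lexx.
  apply: le_trans (hc' _ _) _; rewrite ler_wpM2l ?(ltW (K0' _))//.
  by rewrite prod_normE/= le_max lexx orbT.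
Qed.
End Calculus.

(** * Convex functions *)

Section Convex.
Context {R : realType}.

Definition convex_ineq (Z : lmodType R) (P : Z -> R) := forall (t : R) x y,
  0 <= t <= 1 -> P (t *: x + (1 - t) *: y) <= t * P x + (1 - t) * P y.

Lemma convex_function_ineq (Z : lmodType R) (P : Z -> R) :
  convex_function [set: Z] P -> convex_ineq P.
Proof.
move=> cP t x y /andP[t0 t1].
exact: (cP (Itv01 t0 t1) x y (in_setT _) (in_setT _)).
Qed.

Lemma convex_line (Z : lmodType R) (P : Z -> R) (t : R) y h :
  convex_ineq P -> 0 <= t <= 1 ->
  P (y + t *: h) <= (1 - t) * P y + t * P (y + h).
Proof.
move=> cP t01; rewrite [leRHS]addrC.
have := cP t (y + h) y t01; congr (P _ <= _).
by rewrite scalerDr addrAC -scalerDl (addrC t) subrK scale1r.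
Qed.

(** * Local Lipschitz continuity of finite convex functions *)

Section LocalLipschitz.
Context {Z : normedModType R} (P : Z -> R).
Hypotheses (cP : convex_ineq P) (frameZ : finite_frame Z).

(* By induction on the coordinates, [P] is at most its largest value at the
   vertices of the cube. *)
Lemma convex_cube_bound (I : Type) (e : I -> Z) (r : seq I) z :
  exists B, forall a : I -> R, (forall i, `|a i| <= 1) ->
    P (z + \sum_(i <- r) a i *: e i) <= B.
Proof.
elim: r z => [|i r IH] z.
  by exists (P z) => a _; rewrite big_nil addr0.
have [B1 hB1] := IH (z + e i); have [B2 hB2] := IH (z - e i).
exists (Num.max B1 B2) => a ha; rewrite big_cons.
(* The coefficient [a i] is the average of -1 and 1 with weight [t] on 1, so the point lies between
   its two translates with coefficient -1 and 1. *)
set S := \sum_(j <- r) _; pose t := (1 + a i) / 2.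
have /andP[a1 a2] : - 1 <= a i <= 1 by rewrite -ler_norml.
have t01 : 0 <= t <= 1 by rewrite /t; apply/andP; split; lra.
have -> : z + (a i *: e i + S) = z - e i + S + t *: (2 *: e i).
  rewrite scalerA (_ : t * 2 = 1 + a i); last by rewrite /t; lra.
  by rewrite scalerDl scale1r addrACA subrK addrCA addrC addrA.
apply: le_trans (convex_line _ _ cP t01) _.
have -> : z - e i + S + 2 *: e i = z + e i + S.
  by rewrite scaler_nat mulr2n addrACA subrK -addrA addrC (addrC S) addrA addrC addrA.
have := hB1 a ha; have := hB2 a ha; rewrite -/S => h2 h1.
have : B1 <= Num.max B1 B2 by rewrite le_max lexx.
have : B2 <= Num.max B1 B2 by rewrite le_max lexx orbT.
by move: t01 => /andP[]; nra.
Qed.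

Lemma convex_bounded_above z : exists2 r : R, 0 < r &
  exists B, forall v, `|v| < r -> P (z + v) <= B.
Proof.
have [I [e [c [K [he K0 hc]]]]] := frameZ.
have [B hB] := convex_cube_bound e (index_enum I) z.
(* [S] dominates each [K i], so a vector shorter than [S^-1] has all its coefficients in [-1, 1]. *)
pose S := 1 + \sum_i K i.
have S0 : 0 < S by rewrite ltr_wpDr// sumr_ge0// => i _; rewrite ltW.
exists S^-1; first by rewrite invr_gt0.
exists B => v vS; rewrite [v]he; apply: hB => i; apply: le_trans (hc i v) _.
have : K i <= S.
  rewrite /S (bigD1 i)//= addrCA lerDl addr_ge0// sumr_ge0// => j _.
  by rewrite ltW.
move=> KS; apply: (@le_trans _ _ (S * `|v|)); first exact: ler_wpM2r.
by rewrite mulrC -ler_pdivlMr// mul1r ltW.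
Qed.

(** Reflection through [z] turns the upper bound on a ball into a lower bound. The oscillation is
    thus bounded there, and convexity along a prolonged segment converts it into a slope on the half
    ball. *)
Lemma convex_locally_lipschitz z : exists2 r : R, 0 < r &
  exists2 L : R, 0 <= L &
    forall x y, `|z - x| < r -> `|z - y| < r -> `|P x - P y| <= L * `|x - y|.
Proof.
have [r r0 [B hB]] := convex_bounded_above z.
have hBlow v : `|v| < r -> 2 * P z - B <= P (z + v).
  move=> vr; have hm : P z <= (1 - 1 / 2) * P (z - v) + 1 / 2 * P (z + v).
    have := @convex_line _ P (1 / 2) (z - v) (2 *: v) cP ltac:(lra).
    by rewrite scalerA mul1r mulVf// scale1r subrK scaler_nat mulr2n addrA subrK.
  have := hB (- v); rewrite normrN => /(_ vr); lra.
pose D := 2 * (B - P z).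
have D0 : 0 <= D.
  by have := hB 0; rewrite normr0 addr0 => /(_ r0); rewrite /D; lra.
have osc u v : `|z - u| < r -> `|z - v| < r -> P u - P v <= D.
  rewrite distrC => /hB; rewrite (addrC z) subrK => hu.
  by rewrite distrC => /hBlow; rewrite (addrC z) subrK /D; lra.
have r2 : 0 < r / 2 by rewrite divr_gt0.
exists (r / 2) => //; exists (D / (r / 2)).
  by rewrite divr_ge0 ?(ltW r2).
have main x y : `|z - x| < r / 2 -> `|z - y| < r / 2 ->
    P x - P y <= D / (r / 2) * `|x - y|.
  move=> xr yr; have [->|xy] := eqVneq x y.
    by rewrite !subrr normr0 mulr0.
  set s := `|x - y|; have s0 : 0 < s by rewrite normr_gt0 subr_eq0.
  (* [w] lies on the ray from [y] through [x], at distance [r / 2] beyond [x], hence still in the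
     large ball; and [c^-1] is at most [s / (r / 2)]. *)
  pose c := 1 + r / 2 / s; pose w := y + c *: (x - y).
  have wr : `|z - w| < r.
    rewrite /w /c scalerDl scale1r addrA (addrC y) subrK opprD addrA.
    apply: le_lt_trans (ler_normB _ _) _.
    rewrite normrZ gtr0_norm ?divr_gt0// -/s divfK ?gt_eqF//.
    by lra.
  have c1 : 1 <= c by rewrite lerDl ltW// !divr_gt0.
  have c0 : 0 < c by apply: lt_le_trans c1.
  have t01 : 0 <= c^-1 <= 1 by rewrite invr_ge0 ltW//= invf_le1.
  have := convex_line y (c *: (x - y)) cP t01.
  rewrite scalerA mulVf ?gt_eqF// scale1r -/w addrC subrK => hx.
  have : c^-1 * (P w - P y) <= c^-1 * D.
    rewrite ler_wpM2l ?invr_ge0 ?(ltW c0)//; apply: osc => //.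
    by apply: lt_trans yr _; lra.
  have : c^-1 * D <= D / (r / 2) * s.
    rewrite mulrC -mulrA ler_wpM2l// -[leRHS]invrK lef_pV2 ?posrE ?invr_gt0//.
      by rewrite invfM invrK /c lerDr.
    by rewrite mulr_gt0// invr_gt0.
  lra.
move=> x y xr yr; rewrite ler_norml main// andbT.
by have := main _ _ yr xr; rewrite distrC; lra.
Qed.

(** The increment [h] may leave the ball: shrink it by [t] into the ball, use the Lipschitz bound
    there, and let convexity extend the lower bound from [t *: h] to [h]. *)
Lemma lipschitz_lower_bound z (r L : R) :
  (forall x y, `|z - x| < r -> `|z - y| < r -> `|P x - P y| <= L * `|x - y|) ->
  forall y h, `|z - y| < r -> P y - L * `|h| <= P (y + h).
Proof.
move=> hL y h yr; pose q := r - `|z - y|.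
have q0 : 0 < q by rewrite subr_gt0.
pose t := Num.min 1 (q / (1 + `|h|)).
have h1 : 0 < 1 + `|h| by rewrite ltr_wpDr.
have t0 : 0 < t by rewrite lt_min ltr01 divr_gt0.
have t1 : t <= 1 by rewrite ge_min lexx.
have th : t * `|h| < q.
  apply: (@lt_le_trans _ _ (t * (1 + `|h|))).
    by rewrite ltr_pM2l// ltrDr.
  by rewrite -ler_pdivlMr// ge_min lexx orbT.
have t01 : 0 <= t <= 1 by rewrite (ltW t0) t1.
have := convex_line y h cP t01.
have yth : `|z - (y + t *: h)| < r.
  rewrite opprD addrA; apply: le_lt_trans (ler_normB _ _) _.
  by rewrite normrZ gtr0_norm//; move: th; rewrite /q; lra.
have := hL _ _ yth yr; rewrite (addrC y) addrK normrZ gtr0_norm//.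
move=> /ler_normlP[h2 _] h3.
have : t * (P y - L * `|h|) <= t * P (y + h) by lra.
by rewrite ler_pM2l.
Qed.

End LocalLipschitz.

(* [K] is the graph of a linear relation dominated by [P]. The reduction lies
   below [P], is still finite and convex, and coincides with [K] on the domain
   of [K]; iterated over a frame it produces a linear minorant of [P]. *)
Section InfimalReduction.
Context {Z : lmodType R} (P : Z -> R) (K : set (Z * R)).
Hypotheses (cP : convex_ineq P) (P0 : P 0 = 0) (K0 : K (0, 0)).
Hypothesis K_lin : forall (a b : R) p q, K p -> K q ->
  K (a *: p.1 + b *: q.1, a * p.2 + b * q.2).
Hypothesis K_le : forall p, K p -> p.2 <= P p.1.

Definition infimal_reduction z := inf [set P (z + p.1) - p.2 | p in K].
Local Notation P' := infimal_reduction.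

(** Boundedness below: half of any [(d, r)] in [K] is in [K], and d/2 is the midpoint of z + d and
    -z, so r is at most P(z + d) + P(-z). *)
Lemma infimal_reduction_has_inf z : has_inf [set P (z + p.1) - p.2 | p in K].
Proof.
split; first by exists (P (z + 0) - 0), (0, 0).
exists (- P (- z)) => _ [[d r] Kp <-] /=.
have := K_le (K_lin (1 / 2) 0 Kp K0); rewrite /= scaler0 addr0 mulr0 addr0 => h.
have : P ((1 / 2) *: d) <= 1 / 2 * P (z + d) + 1 / 2 * P (- z).
  have := @cP (1 / 2) (z + d) (- z) ltac:(lra).
  have -> : 1 - 1 / 2 = 1 / 2 :> R by lra.
  by rewrite -scalerDr (addrC z) addrK.
lra.
Qed.

Lemma infimal_reduction_le z p : K p -> P' z <= P (z + p.1) - p.2.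
Proof.
move=> Kp; apply: ge_inf; last by exists p.
by have [] := infimal_reduction_has_inf z.
Qed.

Lemma infimal_reduction_ge z c :
  (forall p, K p -> c <= P (z + p.1) - p.2) -> c <= P' z.
Proof.
move=> h; apply: lb_le_inf; first by have [] := infimal_reduction_has_inf z.
by move=> _ [p Kp <-]; exact: h.
Qed.

Lemma infimal_reduction_convex : convex_ineq P'.
Proof.
move=> t x y /andP[t0 t1].
have key p q : K p -> K q -> P' (t *: x + (1 - t) *: y)
    <= t * (P (x + p.1) - p.2) + (1 - t) * (P (y + q.1) - q.2).
  move=> Kp Kq; have := infimal_reduction_le (t *: x + (1 - t) *: y)
    (K_lin t (1 - t) Kp Kq).
  rewrite /= addrACA -!scalerDr => h.
  have t01 : 0 <= t <= 1 by rewrite t0.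
  by have := @cP t (x + p.1) (y + q.1) t01; lra.
(* The infima over [p] and [q] are taken one after the other. Each divides by its weight, so the
   endpoints of [0, 1] are treated apart. *)
have {}key q : K q -> P' (t *: x + (1 - t) *: y)
    <= t * P' x + (1 - t) * (P (y + q.1) - q.2).
  move=> Kq; have [te0|tn0] := eqVneq t 0.
    by have := key _ _ K0 Kq; rewrite te0 !mul0r.
  have tp : 0 < t by rewrite lt_neqAle eq_sym tn0.
  rewrite -lerBlDr [leRHS]mulrC -ler_pdivrMr//.
  apply: infimal_reduction_ge => p Kp.
  by rewrite ler_pdivrMr// lerBlDr [_ * t]mulrC key.
have [te1|tn1] := eqVneq t 1.
  by have := key _ K0; rewrite te1 subrr !mul0r.
have tp : 0 < 1 - t by rewrite subr_gt0 lt_neqAle tn1.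
rewrite -lerBlDl [leRHS]mulrC -ler_pdivrMr//.
apply: infimal_reduction_ge => p Kp.
by rewrite ler_pdivrMr// lerBlDl [_ * (1 - t)]mulrC key.
Qed.

Lemma infimal_reduction_leP z : P' z <= P z.
Proof. by have := infimal_reduction_le z K0; rewrite /= addr0 subr0. Qed.

Lemma infimal_reduction0 : P' 0 = 0.
Proof.
apply/eqP; rewrite eq_le; apply/andP; split.
  by have := infimal_reduction_leP 0; rewrite P0.
by apply: infimal_reduction_ge => p Kp; rewrite add0r subr_ge0 K_le.
Qed.

(** Translation by an element of [K] reindexes the infimum; the reverse inequality is the same one
    for the opposite element. *)
Lemma infimal_reductionD z p : K p -> P' (z + p.1) = P' z + p.2.
Proof.
have le u q : K q -> P' (u + q.1) <= P' u + q.2.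
  move=> Kq; rewrite -lerBlDr; apply: infimal_reduction_ge => p' Kp'.
  have := infimal_reduction_le (u + q.1) (K_lin 1 (- 1) Kp' Kq).
  rewrite /= scaleN1r !scale1r mul1r addrA addrAC addrK; lra.
move=> Kp; apply/eqP; rewrite eq_le le//=.
have := le (z + p.1) _ (K_lin 0 (- 1) K0 Kp).
by rewrite /= scaler0 add0r scaleN1r addrK; lra.
Qed.

(** Keeps the directions made affine by earlier reductions when the construction is iterated. *)
Lemma infimal_reduction_affine d r :
  (forall z a, P (z + a *: d) = P z + a * r) ->
  forall z a, P' (z + a *: d) = P' z + a * r.
Proof.
move=> hP; have le z a : P' (z + a *: d) <= P' z + a * r.
  rewrite -lerBlDr; apply: infimal_reduction_ge => p Kp.
  have := infimal_reduction_le (z + a *: d) Kp.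
  by rewrite addrAC hP; lra.
move=> z a; apply/eqP; rewrite eq_le le/=.
by have := le (z + a *: d) (- a); rewrite scaleNr addrK; lra.
Qed.

End InfimalReduction.

(** One-dimensional Hahn-Banach: 0 is a convex combination of -s e and t e, so every left difference
    quotient is at most every right one, and the infimum of the right ones serves as slope. *)
Lemma convex_directional_slope (Z : lmodType R) (P : Z -> R) e :
  convex_ineq P -> P 0 = 0 -> exists c : R, forall t : R, t * c <= P (t *: e).
Proof.
move=> cP P0; pose S := [set P (t *: e) / t | t in [set t : R | 0 < t]].
have low (t s : R) : 0 < t -> 0 < s -> - (P (- s *: e) / s) <= P (t *: e) / t.
  move=> t0 s0; have ts : 0 < t + s by rewrite addr_gt0.
  have t01 : 0 <= t / (t + s) <= 1.
    by rewrite divr_ge0 ?(ltW t0) ?(ltW ts)//= ler_pdivrMr// mul1r lerDl ltW.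
  have := @cP (t / (t + s)) (- s *: e) (t *: e) t01.
  have -> : 1 - t / (t + s) = s / (t + s) by field; rewrite gt_eqF.
  rewrite !scalerA -scalerDl.
  have -> : t / (t + s) * - s + s / (t + s) * t = 0 by field; rewrite gt_eqF.
  rewrite scale0r P0 => h.
  have {}h : 0 <= t * P (- s *: e) + s * P (t *: e).
    rewrite -(pmulr_rge0 _ (_ : 0 < (t + s)^-1)) ?invr_gt0//.
    by move: h; congr (_ <= _); field; rewrite gt_eqF.
  rewrite -subr_ge0 opprK -(pmulr_rge0 _ (mulr_gt0 t0 s0)).
  move: h; congr (_ <= _); field; rewrite !gt_eqF//.
have S_inf : has_inf S.
  split; first by exists (P (1 *: e) / 1); exists 1 => //; exact: ltr01.
  by exists (- (P (- 1 *: e) / 1)) => _ [t t0 <-]; exact: (low _ _ t0 ltr01).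
exists (inf S) => t; case: (ltgtP t 0) => [t0|t0|->].
- rewrite mulrC -ler_ndivrMr//; apply: lb_le_inf; first by case: S_inf.
  move=> _ [s s0 <-]; have := low _ (- t) s0; rewrite oppr_gt0 => /(_ t0).
  by rewrite opprK invrN mulrN opprK.
- rewrite mulrC -ler_pdivlMr//; apply: ge_inf; first by case: S_inf.
  by exists t.
- by rewrite mul0r scale0r P0.
Qed.

(** Each vector of [r] costs one reduction along the line of slope [c] through it. The third clause
    carries this gained affinity through the remaining reductions. *)
Lemma convex_affine_minorant (Z : lmodType R) (r : seq Z) (P : Z -> R) :
  convex_ineq P -> P 0 = 0 -> exists P' : Z -> R,
  [/\ forall z, P' z <= P z, P' 0 = 0,
      forall d b, (forall z a, P (z + a *: d) = P z + a * b) ->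
        forall z a, P' (z + a *: d) = P' z + a * b
    & {in r, forall e, exists c, forall z a, P' (z + a *: e) = P' z + a * c}].
Proof.
elim: r P => [|e r IH] P cP P0; first by exists P; split.
have [c hc] := convex_directional_slope e cP P0.
pose K := [set (t *: e, t * c) | t in [set: R]].
have K0 : K (0, 0) by exists 0; rewrite // scale0r mul0r.
have K_lin (a b : R) p q : K p -> K q ->
    K (a *: p.1 + b *: q.1, a * p.2 + b * q.2).
  move=> [s _ <-] [t _ <-] /=; exists (a * s + b * t) => //.
  by rewrite scalerDl mulrDl !scalerA !mulrA.
have K_le p : K p -> p.2 <= P p.1 by move=> [t _ <-] /=.
have [P' [P'P P'0 P'aff P'r]] := IH _
  (infimal_reduction_convex cP K0 K_lin K_le)
  (infimal_reduction0 cP P0 K0 K_lin K_le).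
exists P'; split => //.
- by move=> z; apply: le_trans (P'P z) _; exact: infimal_reduction_leP.
- move=> d b hd; apply: P'aff; exact: infimal_reduction_affine.
- move=> u; rewrite in_cons => /orP[/eqP ->|]; last exact: P'r.
  exists c; apply: P'aff => z a.
  by rewrite (@infimal_reductionD _ _ _ cP K0 K_lin K_le z (a *: e, a * c))//;
    exists a.
Qed.

(* Reducing [P] along the graph of [A w |-> - g w] forces the values of [zeta]
   on [A T]; well-definedness of that map on [A T] is never needed. *)
Lemma convex_multiplier (X : lmodType R) (Z : euclideanType R) (T : set X)
    (A : {linear X -> Z}) (g : X -> R) (P : Z -> R) :
  (forall (a b : R) v w, g (a *: v + b *: w) = a * g v + b * g w) ->
  convex_ineq P -> P 0 = 0 -> T 0 ->
  (forall (a b : R) v w, T v -> T w -> T (a *: v + b *: w)) ->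
  (forall w, T w -> 0 <= g w + P (A w)) ->
  exists zeta, (forall z, inner zeta z <= P z) /\
    (forall w, T w -> g w + inner zeta (A w) = 0).
Proof.
move=> g_lin cP P0 T0 T_lin hT; pose K := [set (A w, - g w) | w in T].
have gZ a w : g (a *: w) = a * g w.
  by rewrite -[X in g X]addr0 -[X in g (_ + X)](scale0r w) g_lin mul0r addr0.
have g0 : g 0 = 0 by rewrite -[X in g X](scale0r 0) gZ mul0r.
have K0 : K (0, 0) by exists 0; rewrite // linear0 g0 oppr0.
have K_lin (a b : R) p q : K p -> K q ->
    K (a *: p.1 + b *: q.1, a * p.2 + b * q.2).
  move=> [v Tv <-] [w Tw <-] /=; exists (a *: v + b *: w); first exact: T_lin.
  by rewrite linearD !linearZ/= g_lin opprD -!mulrN.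
have K_le p : K p -> p.2 <= P p.1.
  by move=> [w Tw <-] /=; rewrite -subr_ge0 opprK addrC hT.
have [s hs] := @exists_parseval_frame R Z.
have [P' [P'P P'0 P'aff P's]] := convex_affine_minorant s
  (infimal_reduction_convex cP K0 K_lin K_le)
  (infimal_reduction0 cP P0 K0 K_lin K_le).
have [c hc] : exists c : Z -> R, {in s, forall e, forall z a,
    P' (z + a *: e) = P' z + a * c e}.
  pose c e := xget 0 [set c : R | forall z a, P' (z + a *: e) = P' z + a * c].
  by exists c => e /P's; exact: xgetPex.
(* Affine along every frame vector and zero at 0, [P'] is the linear form given by its slopes. *)
have P'E z : P' z = inner (\sum_(e <- s) c e *: e) z.
  have h r : {subset r <= s} -> P' (\sum_(e <- r) inner z e *: e)
      = inner (\sum_(e <- r) c e *: e) z.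
    elim: r => [|e r IH] rs; first by rewrite !big_nil inner0l.
    rewrite !big_cons addrC hc ?rs ?mem_head// innerDl innerZl addrC IH.
      by rewrite mulrC innerC.
    by move=> u ur; rewrite rs// in_cons ur orbT.
  by rewrite -h// -[in LHS](hs z).
exists (\sum_(e <- s) c e *: e); split => [z|w Tw]; rewrite -P'E.
  by apply: le_trans (P'P z) _; exact: infimal_reduction_leP.
(* Slope [- g w] along [A w] is created by the first reduction and inherited by [P'], which fixes
   the value of [P'] at [A w]. *)
have affA z a : infimal_reduction P K (z + a *: A w)
    = infimal_reduction P K z + a * - g w.
  rewrite (@infimal_reductionD _ _ _ cP K0 K_lin K_le z
    (a *: A w, a * - g w))//.
  exists (a *: w); first by rewrite -[a *: w]addr0 -(scale0r w); exact: T_lin.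
  by rewrite linearZ/= gZ mulrN.
have := P'aff _ _ affA 0 1; rewrite scale1r add0r P'0 mul1r add0r => ->.
by rewrite subrr.
Qed.

End Convex.

(** * Tangent spaces and retractions *)

Section Geometry.
Context {R : realType}.

Lemma linear_continuous_of_frame (V W : normedModType R) (L : {linear V -> W}) :
  finite_frame V -> continuous L.
Proof.
move=> [I [e [c [K [he K0 hc]]]]]; apply: bounded_linear_continuous.
apply/linear_boundedP; exists (\sum_i K i * `|L (e i)|); split.
  exact: num_real.
move=> r hr v; rewrite [in L v](he v) linear_sum.
apply: le_trans (ler_norm_sum _ _ _) _.
apply: le_trans (ler_wpM2r (normr_ge0 v) (ltW hr)); rewrite mulr_suml.
apply: ler_sum => i _; rewrite linearZ normrZ mulrAC.
exact: ler_wpM2r.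
Qed.

Lemma diff_near_eq (V W : normedModType R) (f g : V -> W) x v :
  differentiable f x -> differentiable g x -> (\near x, f x = g x) ->
  'd f x v = 'd g x v.
Proof. by move=> df dg fg; rewrite -!deriveE// (near_eq_derive _ fg). Qed.

Lemma is_derive_comp_curve (V W : normedModType R) (g : V -> W) (c : R -> V)
    (t : R) v : differentiable c t -> is_derive t 1 c v ->
  differentiable g (c t) -> is_derive t 1 (g \o c) ('d g (c t) v).
Proof.
move=> dc hc dg; have dgc := differentiable_comp dc dg.
apply: DeriveDef; first exact: diff_derivable.
by rewrite deriveE// diff_comp//= -[X in 'd g _ X]deriveE// derive_val.
Qed.

Context {X : euclideanType R}.
Implicit Types (M U V : set X) (phi psi : X -> X).

Lemma linear_euclidean_continuous (W : normedModType R) (L : {linear X -> W}) :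
  continuous L.
Proof. exact/linear_continuous_of_frame/euclidean_finite_frame. Qed.

(** * Tangent vectors in a slice chart *)

Section Chart.
Context {M U V : set X} {phi psi : X -> X} {E : {vspace X}}.
Hypotheses (diffeo : C2_diffeomorphism U V phi psi)
  (chart : M `&` U = U `&` phi @^-1` [set` E]).

Lemma chart_sub y : M y -> U y -> phi y \in E.
Proof. by move=> My Uy; have : (M `&` U) y by []; rewrite chart => -[]. Qed.

Lemma diff_chartK y v : U y -> 'd psi (phi y) ('d phi y v) = v.
Proof.
move=> Uy; have [[oU oV [dphi _] [dpsi _]] [UV VU phiK psiK]] := diffeo.
have dy := dphi _ Uy; have dpy := dpsi _ (UV _ Uy).
have -> : 'd psi (phi y) ('d phi y v) = 'd (psi \o phi) y v.
  by rewrite (diff_comp dy dpy).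
have did : is_diff y (@id X) id by exact: is_diff_id.
have -> : 'd (psi \o phi) y v = 'd (@id X) y v; last by rewrite diff_val.
apply: diff_near_eq; first exact: differentiable_comp.
  exact: ex_diff.
near=> z; apply: phiK; rewrite inE; near: z; exact: open_nbhs_nbhs.
Unshelve. all: by end_near. Qed.

(** The map [L] vanishes exactly on [E]. Along a curve in [M], [L \o phi] is zero near time 0, hence
    so is its derivative there, [L ('d phi y v)]. *)
Lemma tangent_chartP y v : M y -> U y ->
  tangent M y v -> 'd phi y v \in E.
Proof.
have [[oU oV [dphi _] [dpsi _]] [UV VU phiK psiK]] := diffeo.
move=> My Uy [e [c [e0 cC1 Mc c0 dc]]].
have dc0 : differentiable c 0 by have [] := cC1 0 (ballxx _ e0).
pose L := (\1 - projv E)%VF.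
have LE w : L w = w - projv E w.
  by rewrite /L add_lfunE opp_lfunE id_lfunE.
have cL := @linear_euclidean_continuous _ L.
have dcy : differentiable phi (c 0) by rewrite c0; exact: dphi.
have h1 := is_derive_comp_curve dc0 dc dcy.
have dpc := differentiable_comp dc0 dcy.
have h2 := is_derive_comp_curve dpc h1 (linear_differentiable _ cL).
have Ucn : \forall t \near (0 : R), U (c t).
  have : nbhs (c 0) U by rewrite c0; exact: open_nbhs_nbhs.
  exact: differentiable_continuous dc0 _.
have h3 : \forall t \near (0 : R), (L \o (phi \o c)) t = (cst 0 : R -> X) t.
  near=> t; rewrite /= LE projv_id ?subrr//; apply: chart_sub.
    by apply: Mc; near: t; exact: nbhsx_ballx.
  by near: t.
have := @near_eq_derive _ R X _ _ _ 1 h3; rewrite derive_val derive_cst.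
rewrite diff_lin// c0 => Lw0.
have /eqP : L ('d phi y v) = 0 by [].
rewrite LE subr_eq0 => /eqP ->.
exact: memv_proj.
Unshelve. all: by end_near. Qed.

(** The required curve is the preimage of the straight line through [phi y] with direction [e]: it
    stays in [E], and [psi] sends it back into [M]. *)
Lemma chart_tangent y e : M y -> U y -> e \in E ->
  tangent M y ('d psi (phi y) e).
Proof.
have [[oU oV _ [dpsi C1psi]] [UV VU phiK psiK]] := diffeo.
move=> My Uy Ee; pose l (t : R) := phi y + t *: e; pose c t := psi (l t).
have Vy := UV _ Uy.
have cl : continuous l.
  by move=> t; apply: cvgD; [exact: cvg_cst|apply: cvgZr_tmp; exact: cvg_id].
have /nbhs_ballP[r /= r0 hr] : \forall t \near (0 : R), V (l t).
  by apply: cl; apply: open_nbhs_nbhs; split; rewrite // /l scale0r addr0.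
have dl t : is_diff t l (fun s : R => s *: e).
  by apply: is_diff_eq; rewrite add0r.
have dc t : ball 0 r t -> differentiable c t.
  move=> /hr Vt; apply: differentiable_comp (dpsi _ Vt).
  by case: (dl t).
have dcE t s : ball 0 r t -> 'd c t s = 'd psi (l t) (s *: e).
  case: (dl t) => dlt dlE /hr Vt.
  by rewrite (diff_comp dlt (dpsi _ Vt))/= dlE.
exists r, c; split => //.
- move=> t rt; split; first exact: dc.
  have bt : nbhs t (ball (0 : R) r).
    by apply: open_nbhs_nbhs; split => //; exact: ball_open.
  move=> s; rewrite /prop_for /continuous_at dcE//.
  have h : (fun t => 'd psi (l t) (s *: e)) t' @[t' --> t]
      --> 'd psi (l t) (s *: e).
    apply: (@continuous_comp _ _ _ l (fun z => 'd psi z (s *: e))); first exact: cl.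
    by apply: differentiable_continuous; have [] := C1psi (s *: e) _ (hr _ rt).
  apply: cvg_trans h; apply: near_eq_cvg; near=> t'; rewrite dcE//.
  by near: t'; exact: bt.
- move=> t /hr Vt; have Uc := VU _ Vt.
  have : (U `&` phi @^-1` [set` E]) (c t).
    split=> //=; rewrite /c psiK ?inE// /l memvD ?memvZ//; exact: chart_sub.
  by rewrite -chart => -[].
- by rewrite /c /l scale0r addr0 phiK// inE.
- have := @is_derive_line R X X psi (phi y) e 0.
  by rewrite scale0r addr0; apply; exact: dpsi.
Unshelve. all: by end_near. Qed.

End Chart.

Lemma tangent_subspace d M x : C2_submanifold d M -> M x -> tangent M x 0 /\
  forall (a b : R) v w, tangent M x v -> tangent M x w ->
    tangent M x (a *: v + b *: w).
Proof.
move=> cM Mx; have [U [V [phi [psi [E [Ux diffeo _ chart]]]]]] := cM x Mx.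
split=> [|a b v w hv hw].
  rewrite -(linear0 ('d psi (phi x))).
  by apply: (chart_tangent diffeo chart) => //; exact: mem0v.
rewrite -(diff_chartK diffeo v Ux) -(diff_chartK diffeo w Ux).
rewrite -!linearZ -linearD; apply: (chart_tangent diffeo chart) => //.
by apply: memvD; rewrite linearZ memvZ//; exact: (tangent_chartP diffeo chart).
Qed.

(** Lets a test direction at the cluster point be imitated at the iterates. The chart coordinates of
    [w] are frozen and pushed back at [phi y]; ['d psi] depends continuously on its base point. *)
Lemma tangent_lower_semicontinuous d M x w : C2_submanifold d M -> M x ->
  tangent M x w -> forall e : R, 0 < e ->
  \forall y \near x, M y -> exists2 w', tangent M y w' & `|w - w'| < e.
Proof.
move=> cM Mx Tw e e0.
have [U [V [phi [psi [E [Ux diffeo _ chart]]]]]] := cM x Mx.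
have [[oU oV [dphi _] [_ C1psi]] [UV _ _ _]] := diffeo.
pose W y := 'd psi (phi y) ('d phi x w).
have cW : {for x, continuous W}.
  apply: (@continuous_comp _ _ _ phi (fun z => 'd psi z ('d phi x w))).
    exact/differentiable_continuous/dphi.
  by apply: differentiable_continuous; have [] := C1psi ('d phi x w) _ (UV _ Ux).
have Wx : W x = w by rewrite /W (diff_chartK diffeo).
move/cvgrPdist_lt : cW => /(_ _ e0); rewrite Wx => cW.
near=> y => My; exists (W y).
  apply: (chart_tangent diffeo chart) => //.
    by near: y; exact: open_nbhs_nbhs.
  exact: (tangent_chartP diffeo chart).
by near: y.
Unshelve. all: by end_near. Qed.

(** The derivative clause of [retraction] holds at each point separately; uniformity in [y] comes
    from strict differentiability of a local extension [G] at [(x, 0)]. *)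
Lemma retraction_first_order d M (Rt : X -> X -> X) x :
  C2_submanifold d M -> retraction M Rt -> M x -> forall e : R, 0 < e ->
  exists2 r : R, 0 < r & forall y v, M y -> tangent M y v ->
    `|x - y| < r -> `|v| < r -> `|Rt y v - y - v| <= e * `|v|.
Proof.
move=> cM [_ RC1 R0 dR] Mx e e0.
have [Tx0 _] := tangent_subspace cM Mx.
have [U [G [oU Ux CG GR]]] := RC1 (x, 0) (conj Mx Tx0).
have cG : continuously_differentiable G (x, 0).
  apply: C1_continuously_differentiable Ux CG => //.
  by apply: prod_finite_frame; exact: euclidean_finite_frame.
have e3 : 0 < e / 3 by rewrite divr_gt0.
have [r1 r10 hG] :=
  strict_differentiability (@euclidean_normed_by_dual R X) cG e3.
have /nbhs_normP[r2 /= r20 hU] : nbhs (x, 0) U by exact: open_nbhs_nbhs.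
pose D v := 'd G (x, 0) (0, v).
have nrm (y v : X) (q : R) : `|x - y| < q -> `|v| < q ->
    `|(x, 0) - (y, v)| < q.
  by move=> yq vq; rewrite prod_normE/= gt_max yq/= sub0r normrN.
(* Only the second slot varies, so the estimate involves the partial derivative [D] alone, frozen at
   [(x, 0)]. *)
have key y v : M y -> tangent M y v -> `|x - y| < r1 -> `|v| < r1 ->
    `|x - y| < r2 -> `|v| < r2 -> `|Rt y v - y - D v| <= e / 3 * `|v|.
  move=> My Tv y1 v1 y2 v2; have [Ty0 _] := tangent_subspace cM My.
  have n0 q : 0 < q -> `|0 : X| < q by rewrite normr0.
  have := hG (y, 0) (y, v) (nrm _ _ _ y1 (n0 _ r10)) (nrm _ _ _ y1 v1).
  have -> : (y, v) - (y, 0) = (0, v) :> X * X.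
    by rewrite -[LHS]/(y - y, v - 0) subrr subr0.
  rewrite (GR (y, v)) ?(GR (y, 0))//=.
  - by rewrite R0// prod_normE/= normr0 max_r.
  - by apply: hU; exact: nrm (n0 _ r20).
  - by apply: hU; exact: nrm.
exists (Num.min r1 r2); first by rewrite lt_min r10.
move=> y v My Tv; rewrite !lt_min => /andP[y1 y2] /andP[v1 v2].
have DZ (t : R) : D (t *: v) = t *: D v.
  by rewrite /D -linearZ; congr ('d G _ _); rewrite -[RHS]/(_, _) scaler0.
suff : `|D v - v| <= 2 * e / 3 * `|v|.
  have := key y v My Tv y1 v1 y2 v2.
  have -> : Rt y v - y - v = (Rt y v - y - D v) + (D v - v) by rewrite addrA subrK.
  by move=> h1 h2; apply: le_trans (ler_normD _ _) _; lra.
(* The radius [r3] depends on [y], but the bound on [D v - v] is homogeneous in [v]: it is proved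
   for a multiple [t *: v] short enough for [r3]. *)
have /nbhs_normP[r3 /= r30 hr3] := dR y My _ e3.
pose t := Num.min 1 (r3 / (1 + `|v|)).
have v10 : 0 < 1 + `|v| by rewrite ltr_wpDr.
have t0 : 0 < t by rewrite lt_min ltr01 divr_gt0.
have t1 : t <= 1 by rewrite ge_min lexx.
have th : t * `|v| < r3.
  apply: (@lt_le_trans _ _ (t * (1 + `|v|))).
    by rewrite ltr_pM2l// ltrDr.
  by rewrite -ler_pdivlMr// ge_min lexx orbT.
have ntv : `|t *: v| = t * `|v| by rewrite normrZ gtr0_norm.
have tv q : `|v| < q -> `|t *: v| < q.
  by rewrite ntv; apply: le_lt_trans; rewrite ler_piMl.
have Ttv : tangent M y (t *: v).
  have [Ty0 lin] := tangent_subspace cM My.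
  by have := lin t 0 v v Tv Tv; rewrite scale0r addr0.
have h1 := key y _ My Ttv y1 (tv _ v1) y2 (tv _ v2).
have := hr3 (t *: v); rewrite /ball_/= sub0r normrN ntv R0// => /(_ th Ttv) h2.
have : `|t *: (D v - v)| <= t * (2 * e / 3 * `|v|).
  have -> : t *: (D v - v)
      = (Rt y (t *: v) - y - t *: v) - (Rt y (t *: v) - y - D (t *: v)).
    by rewrite DZ scalerBr opprB addrCA [X in _ = _ + X]addrAC subrr sub0r.
  by apply: le_trans (ler_normB _ _) _; rewrite ntv in h1; lra.
by rewrite normrZ gtr0_norm// ler_pM2l.
Qed.

End Geometry.

(** * First-order estimates along a retraction *)

Section LocalModel.
Context {R : realType} {X : euclideanType R}.

Lemma lipschitz_gradient_continuously_differentiable (O : set X) (g : X -> R) x :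
  open O -> (forall y, O y -> differentiable g y) ->
  locally_lipschitz_on O (gradient g) -> O x ->
  continuously_differentiable g x.
Proof.
move=> oO dg lg Ox e e0; have [U xU] := lg x Ox.
move=> /pinfty_ex_gt0[K K0 hK].
near=> y; split; first by apply: dg; near: y; exact: open_nbhs_nbhs.
move=> v; rewrite -!inner_gradient -innerBl.
apply: le_trans (cauchy_schwarz _ _) _; rewrite ler_wpM2r//.
have Uy : U y by near: y.
have /= h := hK (y, x) (conj Uy (nbhs_singleton xU)).
apply: le_trans h _; rewrite mulrC -ler_pdivlMr// distrC ltW//.
near: y; apply/nbhs_normP; exists (e / K) => //=; exact: divr_gt0.
Unshelve. all: by end_near. Qed.

Lemma lipschitz_diff_continuously_differentiable (W : normedModType R)
    (O : set X) (g : X -> W) x :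
  open O -> (forall y, O y -> differentiable g y) ->
  diff_locally_lipschitz_on O g -> O x -> continuously_differentiable g x.
Proof.
move=> oO dg lg Ox e e0; have [U xU [L hL]] := lg x Ox.
have L0 : 0 < `|L| + 1 by rewrite ltr_wpDl.
near=> y; split; first by apply: dg; near: y; exact: open_nbhs_nbhs.
move=> v; have Uy : U y by near: y.
apply: le_trans (hL _ _ Uy (nbhs_singleton xU) v) _; rewrite ler_wpM2r//.
apply: (@le_trans _ _ ((`|L| + 1) * `|y - x|)).
  by rewrite ler_wpM2r// (le_trans (ler_norm _))// lerDl.
rewrite mulrC -ler_pdivlMr// distrC ltW//.
near: y; apply/nbhs_normP; exists (e / (`|L| + 1)) => //=; exact: divr_gt0.
Unshelve. all: by end_near. Qed.

Context {W : normedModType R}.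
Implicit Types (g : X -> W).

Lemma linear_le (L : {linear X -> W}) :
  exists2 C : R, 0 < C & forall v, `|L v| <= C * `|v|.
Proof. exact/linear_lipschitz/linear_euclidean_continuous. Qed.

Lemma continuously_differentiable_continuous g x :
  continuously_differentiable g x -> forall e : R, 0 < e ->
  exists2 r : R, 0 < r & forall y, `|x - y| < r -> `|g x - g y| < e.
Proof.
move=> cg e e0; have /nbhs_singleton[dg _] := cg _ ltr01.
have /cvgrPdist_lt/(_ _ e0)/nbhs_normP[r r0 hr] := differentiable_continuous dg.
by exists r.
Qed.

Lemma continuously_differentiable_near g x :
  continuously_differentiable g x -> forall e : R, 0 < e ->
  exists2 r : R, 0 < r & forall y, `|x - y| < r ->
    forall v, `|'d g y v - 'd g x v| <= e * `|v|.
Proof.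
move=> cg e e0; have /nbhs_normP[r r0 hr] := cg e e0.
by exists r => // y /hr[].
Qed.

Lemma continuously_differentiable_bounded g x :
  continuously_differentiable g x -> exists2 C : R, 0 < C &
  exists2 r : R, 0 < r & forall y, `|x - y| < r ->
    forall v, `|'d g y v| <= C * `|v|.
Proof.
move=> cg; have [C C0 hC] := linear_le ('d g x).
have [r r0 hr] := continuously_differentiable_near cg ltr01.
exists (1 + C); first by rewrite addr_gt0.
exists r => // y yr v; rewrite -(subrK ('d g x v) ('d g y v)).
apply: le_trans (ler_normD _ _) _; rewrite mulrDl.
by apply: lerD; [exact: hr|exact: hC].
Qed.

Lemma continuously_differentiable_joint g x w :
  continuously_differentiable g x -> forall e : R, 0 < e ->
  exists2 r : R, 0 < r & forall y u, `|x - y| < r -> `|w - u| < r ->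
    `|'d g x w - 'd g y u| < e.
Proof.
move=> cg e e0; have [C C0 [r1 r10 hC]] := continuously_differentiable_bounded cg.
have w0 : 0 < 1 + `|w| by rewrite ltr_wpDr.
have e2 : 0 < e / 2 / (1 + `|w|) by rewrite !divr_gt0.
have [r2 r20 hr] := continuously_differentiable_near cg e2.
pose r3 := e / 2 / C; have r30 : 0 < r3 by rewrite !divr_gt0.
exists (Num.min r1 (Num.min r2 r3)); first by rewrite !lt_min r10 r20.
move=> y u; rewrite !lt_min => /and3P[y1 y2 _] /and3P[_ _ u3].
have -> : 'd g x w - 'd g y u = ('d g x w - 'd g y w) + 'd g y (w - u).
  by rewrite linearB addrA subrK.
apply: le_lt_trans (ler_normD _ _) _; rewrite (splitr e); apply: ler_ltD.
  rewrite distrC; apply: le_trans (hr _ y2 w) _.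
  by rewrite mulrAC ler_pdivrMr// ler_pM2l ?divr_gt0// lerDr.
apply: le_lt_trans (hC _ y1 _) _.
by rewrite mulrC -ltr_pdivlMr.
Qed.

(** Three errors: strict differentiability of [g] between [y] and [Rt y v], replacement of
    [Rt y v - y] by [v], and replacement of ['d g x] by ['d g y]. *)
Lemma first_order_along_retraction d (M : set X) (Rt : X -> X -> X) g x :
  normed_by_dual W -> C2_submanifold d M -> retraction M Rt -> M x ->
  continuously_differentiable g x -> forall e : R, 0 < e ->
  exists2 r : R, 0 < r & forall y v, M y -> tangent M y v ->
    `|x - y| < r -> `|v| < r ->
    `|g (Rt y v) - g y - 'd g y v| <= e * `|v|.
Proof.
move=> dualW cM hR Mx cg e e0.
have [C C0 hC] := linear_le ('d g x).
(* Since [e2 <= 1] the step has length at most 2|v|, so the three errors cost 2 [e1], [e2 * C] and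
   [e1] times |v|, at most [e] in total. *)
pose e1 := e / 4; have e10 : 0 < e1 by rewrite divr_gt0.
pose e2 := Num.min 1 (e / 4 / C).
have e20 : 0 < e2 by rewrite lt_min ltr01 !divr_gt0.
have e2C : e2 * C <= e / 4 by rewrite -ler_pdivlMr// ge_min lexx orbT.
have e21 : e2 <= 1 by rewrite ge_min lexx.
have [r1 r10 h1] := strict_differentiability dualW cg e10.
have [r2 r20 h2] := retraction_first_order cM hR Mx e20.
have [r3 r30 h3] := continuously_differentiable_near cg e10.
exists (Num.min (r1 / 3) (Num.min r2 r3)).
  by rewrite !lt_min divr_gt0//= r20.
move=> y v My Tv; rewrite !lt_min => /and3P[y1 y2 y3] /and3P[v1 v2 v3].
have hRt := h2 y v My Tv y2 v2.
have hstep : `|Rt y v - y| <= 2 * `|v|.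
  rewrite -(subrK v (Rt y v - y)); apply: le_trans (ler_normD _ _) _.
  have : e2 * `|v| <= 1 * `|v| by rewrite ler_wpM2r.
  lra.
have yr1 : `|x - y| < r1 by lra.
have Rr1 : `|x - Rt y v| < r1.
  rewrite -(subrK y x) -addrA -[y - _]opprB.
  by apply: le_lt_trans (ler_normB _ _) _; lra.
have k1 := h1 y _ yr1 Rr1.
have k2 := hC (Rt y v - y - v).
have k3 := h3 y y3 v.
have -> : g (Rt y v) - g y - 'd g y v = (g (Rt y v) - g y - 'd g x (Rt y v - y))
    + 'd g x (Rt y v - y - v) - ('d g y v - 'd g x v).
  by rewrite [in 'd g x (_ - v)]linearB addrA subrK opprB addrA subrK.
apply: le_trans (ler_normB _ _) _; apply: le_trans (lerD (ler_normD _ _) k3) _.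
have : e1 * `|Rt y v - y| <= e1 * (2 * `|v|) by rewrite ler_wpM2l// ltW.
have : C * `|Rt y v - y - v| <= C * (e2 * `|v|) by rewrite ler_wpM2l// ltW.
have : C * (e2 * `|v|) <= e / 4 * `|v|.
  by rewrite mulrA (mulrC C) ler_wpM2r.
by rewrite /e1 in k1 k3 *; lra.
Qed.

End LocalModel.

(** * Runs of the algorithm *)

Section Rivmpl.
Context {R : realType} {X Z : euclideanType R}.
Context {d : nat} {M O : set X} {f : X -> \bar R} {theta : Z -> R} {F : X -> Z}.
Hypothesis hP : standing_assumptions d M O f theta F.
Local Notation fr := (fine \o f).

Let oO : open O. Proof. by case: hP => -[]. Qed.
Let cM : C2_submanifold d M. Proof. by case: hP => -[[]]. Qed.
Let closedM : closed M. Proof. by case: hP => -[[]]. Qed.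
Let MO x : M x -> O x. Proof. by case: hP => -[_ _ _ +] _; exact. Qed.
Let f_fin x : O x -> f x \is a fin_num. Proof. by case: hP => _ [[_ _ + _ _] _ _ _]; exact. Qed.
Let ctheta : convex_ineq theta.
Proof. by case: hP => _ [_ + _ _]; exact: convex_function_ineq. Qed.

Let fr_C1 x : O x -> continuously_differentiable fr x.
Proof.
case: hP => _ [[_ _ _ df lf] _ _ _].
exact: lipschitz_gradient_continuously_differentiable.
Qed.

Let F_C1 x : O x -> continuously_differentiable F x.
Proof.
by case: hP => _ [_ _ [dF lF] _]; exact: lipschitz_diff_continuously_differentiable.
Qed.

Definition real_objective x : R := fr x + theta (F x).

Lemma objectiveE x : O x -> objective f theta F x = (real_objective x)%:E.
Proof. by move=> Ox; rewrite /objective /real_objective EFinD /= fineK// f_fin. Qed.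

Lemma real_objective_bounded_below : exists m, forall x, M x ->
  m <= real_objective x.
Proof.
case: hP => _ [_ _ _ lb].
have le x : M x -> (ereal_inf (objective f theta F @` M)
    <= (real_objective x)%:E)%E.
  by move=> Mx; rewrite -(objectiveE (MO Mx)); apply: ereal_inf_lbound; exists x.
move: lb le; case: ereal_inf => [m|_|] //.
  by move=> _ le; exists m => x Mx; rewrite -lee_fin le.
by move=> le; exists 0 => x /le.
Qed.

Lemma modelE x (Q : X -> X) v : model f theta F x Q v =
  'd fr x v + 2^-1 * inner v (Q v) + theta (F x + 'd F x v) + fr x.
Proof. by rewrite /model inner_gradient /linearization (addrC x) addrK. Qed.

Lemma model0 x (Q : {linear X -> X}) : model f theta F x Q 0 = real_objective x.
Proof.
by rewrite modelE !linear0 mulr0 !addr0 add0r addrC.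
Qed.

(** Valid for [v] of any length, so it bounds trial steps before they are known to be small. *)
Lemma theta_lower_bound x : O x -> exists2 C : R, 0 < C &
  exists2 r : R, 0 < r & forall y, `|x - y| < r -> forall v,
    theta (F y) - C * `|v| <= 'd fr y v + theta (F y + 'd F y v).
Proof.
move=> Ox; have frameZ := @euclidean_finite_frame R Z.
have [r0 r00 [L L0 hL]] := convex_locally_lipschitz ctheta frameZ (F x).
have [r1 r10 h1] := continuously_differentiable_continuous (F_C1 Ox) r00.
have [C1 C10 [r2 r20 h2]] := continuously_differentiable_bounded (F_C1 Ox).
have [C2 C20 [r3 r30 h3]] := continuously_differentiable_bounded (fr_C1 Ox).
exists (C2 + L * C1); first by rewrite ltr_pwDl// mulr_ge0// ltW.
exists (Num.min r1 (Num.min r2 r3)); first by rewrite !lt_min r10 r20.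
move=> y; rewrite !lt_min => /and3P[y1 y2 y3] v.
have k1 := lipschitz_lower_bound ctheta hL ('d F y v) (h1 y y1).
have k2 : L * `|'d F y v| <= L * (C1 * `|v|) by rewrite ler_wpM2l// h2.
have /ler_normlP[k3 _] := h3 y y3 v.
by lra.
Qed.

(** [theta] is Lipschitz near [F x], so it passes on the o(|v|) error between [F (Rt y v)] and the
    linearization; the subtraction removes the quadratic term of the model. *)
Lemma retraction_model_error Rt x : retraction M Rt -> M x ->
  forall e : R, 0 < e -> exists2 r : R, 0 < r &
  forall y v, M y -> tangent M y v -> `|x - y| < r -> `|v| < r -> forall Q,
    real_objective (Rt y v)
      <= model f theta F y Q v - 2^-1 * inner v (Q v) + e * `|v|.
Proof.
move=> hR Mx e e0; have Ox := MO Mx; have frameZ := @euclidean_finite_frame R Z.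
have [q q0 [L L0 hL]] := convex_locally_lipschitz ctheta frameZ (F x).
have e2 : 0 < e / 2 by rewrite divr_gt0.
have L1 : 0 < L + 1 by rewrite ltr_wpDl.
have eL : 0 < e / 2 / (L + 1) by rewrite !divr_gt0.
have q2 : 0 < q / 2 by rewrite divr_gt0.
have [r1 r10 h1] := first_order_along_retraction (@real_normed_by_dual R) cM hR Mx
  (fr_C1 Ox) e2.
have [r2 r20 h2] := first_order_along_retraction (@euclidean_normed_by_dual R Z)
  cM hR Mx (F_C1 Ox) eL.
have [r3 r30 h3] := continuously_differentiable_continuous (F_C1 Ox) q2.
have [C C0 [r4 r40 h4]] := continuously_differentiable_bounded (F_C1 Ox).
have [r5 r50 h5] := retraction_first_order cM hR Mx ltr01.
pose r6 := Num.min (r3 / 3) (q / 2 / C).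
have r60 : 0 < r6 by rewrite lt_min !divr_gt0.
exists (Num.min (Num.min r1 r2) (Num.min (Num.min r4 r5) r6)).
  by rewrite !lt_min r10 r20 r40 r50 !divr_gt0.
move=> y v My Tv; rewrite !lt_min -!andbA => /and5P[y1 y2 y4 y5 /andP[y3 _]].
move=> /and5P[v1 v2 v4 v5 /andP[v3 vC]] Q.
have k1 := h1 y v My Tv y1 v1; have k2 := h2 y v My Tv y2 v2.
have Fy : `|F x - F y| < q / 2 by apply: h3; lra.
have FRy : `|F x - F (Rt y v)| < q.
  have hRv : `|x - Rt y v| < r3.
    have -> : x - Rt y v = (x - y) - (Rt y v - y - v) - v.
      by rewrite -addrA -[- _ - v]opprD subrK opprB addrA subrK.
    apply: le_lt_trans (ler_normB _ _) _.
    have := ler_normB (x - y) (Rt y v - y - v).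
    by have := h5 y v My Tv y5 v5; lra.
  by have := h3 _ hRv; lra.
have Flin : `|F x - (F y + 'd F y v)| < q.
  rewrite opprD addrA; apply: le_lt_trans (ler_normB _ _) _.
  have := h4 y y4 v; move: vC; rewrite ltr_pdivlMr// (mulrC _ C); lra.
have := hL _ _ FRy Flin; rewrite opprD addrA => /ler_normlP[_ k3].
have k4 : L * `|F (Rt y v) - F y - 'd F y v| <= e / 2 * `|v|.
  apply: (@le_trans _ _ (L * (e / 2 / (L + 1) * `|v|))).
    exact: ler_wpM2l.
  rewrite mulrA ler_wpM2r// mulrCA ler_piMr ?(ltW e2)//.
  by rewrite ler_pdivrMr// mul1r lerDl.
move: k1 => /ler_normlP[_ k1].
by rewrite modelE /real_objective; lra.
Qed.

(** Two stages: descent of the model gives the crude bound alpha |v| <= 2C, which brings [v] into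
    the range of [retraction_model_error]; the failed test then sharpens it. *)
Lemma rejected_step_small Rt p x : retraction M Rt -> rivmpl_params_ok p ->
  M x -> forall e : R, 0 < e -> exists2 r : R, 0 < r & exists B : R,
  forall y v (Q : {linear X -> X}) alpha, M y -> tangent M y v ->
    `|x - y| < r -> B <= alpha ->
    loewner_le (fun u => alpha *: u) Q ->
    model f theta F y Q v <= model f theta F y Q 0 ->
    ~ accepted f theta F p Rt y Q v ->
    [/\ 0 < `|v|, `|v| < e & (alpha_bar p + alpha) * `|v| < e].
Proof.
move=> hR [_ _ abar0 gbar0 _] Mx e e0; have Ox := MO Mx.
have e8 : 0 < e / 8 by rewrite divr_gt0.
have [C C0 [r1 r10 h1]] := theta_lower_bound Ox.
have [r2 r20 h2] := retraction_model_error hR Mx e8.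
exists (Num.min r1 r2); first by rewrite lt_min r10.
(* The last summand forces |v| < [r2] out of the crude bound; the others make [alpha_bar p + alpha]
   at least 1 and at most twice [alpha - gamma_bar p]. *)
exists (1 + alpha_bar p + 2 * gamma_bar p + 3 * C / r2).
move=> y v Q alpha My Tv; rewrite lt_min => /andP[y1 y2] Ba Qa desc rej.
have v0 : 0 < `|v|.
  by rewrite lt_neqAle normr_ge0 andbT eq_sym; apply/eqP => v0; apply: rej; right.
have Cr : 0 < 3 * C / r2 by rewrite !divr_gt0// mulr_gt0.
have a0 : 0 < alpha by lra.
have aQ : alpha * `|v| ^+ 2 <= inner v (Q v).
  by have := Qa v; rewrite innerZr -sqr_norm_inner.
have av : alpha * `|v| <= 2 * C.
  have k1 := h1 y y1 v; move: desc; rewrite model0 modelE /real_objective => desc.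
  have : alpha * `|v| ^+ 2 <= 2 * C * `|v| by lra.
  by rewrite expr2 mulrA ler_pM2r.
have v2 : `|v| < r2.
  have : 3 * C / r2 * `|v| < 3 * C.
    apply: (@le_lt_trans _ _ (alpha * `|v|)); last by lra.
    by rewrite ler_pM2r//; lra.
  by rewrite mulrAC ltr_pdivrMr// ltr_pM2l// mulr_gt0.
have Rty : M (Rt y v) by case: hR => + _ _ _; apply.
have {}rej : model f theta F y Q v - gamma_bar p / 2 * `|v| ^+ 2
    < real_objective (Rt y v).
  rewrite ltNge; apply/negP => h; apply: rej; left.
  by rewrite objectiveE ?lee_fin//; exact: MO.
have k2 := h2 y v My Tv y2 v2 Q.
have : (alpha - gamma_bar p) * `|v| ^+ 2 < e / 4 * `|v| by lra.
rewrite expr2 mulrA ltr_pM2r// => k3.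
have k4 : (alpha_bar p + alpha) * `|v| <= 2 * (alpha - gamma_bar p) * `|v|.
  by rewrite ler_pM2r//; lra.
have k5 : 1 * `|v| <= (alpha_bar p + alpha) * `|v| by rewrite ler_pM2r//; lra.
by split=> //; lra.
Qed.

(** * Estimates along one run *)

Section Run.
Context {p : rivmpl_params R} {Rt : X -> X -> X} {x : nat -> X}.
Context {t : rivmpl_trace X}.
Hypotheses (hR : retraction M Rt) (hp : rivmpl_params_ok p).
Hypothesis run : rivmpl_run M f theta F p Rt x t.
Local Notation v k := (t_v t k (t_stop t k)).
Local Notation alpha k := (t_alpha t k (t_stop t k)).

Lemma run_inner k j : (j <= t_stop t k)%N ->
  inner_iteration M f theta F p (x k) (t_mu t k) (t_alpha t k j)
    (t_Q t k j) (t_v t k j) (t_vbar t k j) (t_LB t k j).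
Proof. by case: run => _ /(_ k) [_ + _ _ _]; apply. Qed.

Lemma run_in_manifold k : M (x k).
Proof.
elim: k => [|k IH]; first by case: run.
have [_ _ [Tv _] _ _] := run_inner (leqnn (t_stop t k)).
have [_ /(_ k) [_ _ _ _ [_ ->]]] := run.
by case: hR => + _ _ _; apply.
Qed.

Lemma run_step_neq0 k : 0 < `|v k|.
Proof.
have [_ /(_ k) [_ _ _ _ [/eqP v0 _]]] := run.
by rewrite lt_neqAle eq_sym v0 normr_ge0.
Qed.

Lemma run_descent k : real_objective (x k.+1)
  <= real_objective (x k) - gamma_bar p / 2 * `|v k| ^+ 2.
Proof.
have [_ _ _ desc _] := run_inner (leqnn (t_stop t k)).
have [_ /(_ k) [_ _ _ acc [v0 xk]]] := run.
case: acc => // acc; move: desc; rewrite model0 => desc.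
have := acc; rewrite -xk objectiveE ?lee_fin; last exact/MO/run_in_manifold.
by move=> h; apply: le_trans h _; rewrite lerD2r.
Qed.

Lemma run_steps_vanish e : 0 < e -> exists N, forall k, (N <= k)%N -> `|v k| < e.
Proof.
move=> e0; have [m hm] := real_objective_bounded_below.
have [_ _ _ g0 _] := hp.
pose u k := real_objective (x k).
have du k : u k.+1 <= u k.
  apply: le_trans (run_descent k) _.
  by rewrite gerBl mulr_ge0 ?exprn_ge0// divr_ge0// ltW.
have cu : cvgn u.
  apply: nonincreasing_is_cvgn.
    apply/nonincreasing_seqP => k; exact: du.
  by exists m => _ [k _ <-]; apply: hm; exact: run_in_manifold.
(* This is the decrease forced by a step of length [e]; two consecutive values within half of it of
   the limit exclude such a step. *)
have q0 : 0 < gamma_bar p / 2 * e ^+ 2 by rewrite mulr_gt0 ?divr_gt0 ?exprn_gt0.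
have /cvgrPdist_lt/(_ _ (divr_gt0 q0 (ltr0Sn R 1)))[N _ hN] := cu.
exists N => k Nk.
have := hN k Nk; have := hN k.+1 (leqW Nk); rewrite /=.
move=> /ltr_normlP[_ h1] /ltr_normlP[h2 _].
have := run_descent k; rewrite -/(u k) -/(u k.+1) => h3.
have : gamma_bar p / 2 * `|v k| ^+ 2 < gamma_bar p / 2 * e ^+ 2 by lra.
by rewrite ltr_pM2l ?divr_gt0// ltr_pXn2r ?nnegrE ?(ltW e0)//.
Qed.

Lemma run_alpha_ge k j : (j <= t_stop t k)%N -> alpha_min p <= t_alpha t k j.
Proof.
have [/andP[amin _] _ _ _ sigma1] := hp.
have [_ /(_ k) [[/andP[a0 _] _] _ rej _ _]] := run.
elim: j => [//|j IH] jJ; have [_ ->] := rej j jJ.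
have := IH (ltnW jJ) => h; apply: le_trans h _.
by rewrite ler_peMl// ltW// (lt_le_trans amin)// IH// ltnW.
Qed.

(** Chains the inexactness test through [t_LB] and the exact minimizer, so that later arguments see
    only the computed step. *)
Lemma run_near_optimal k j w : (j <= t_stop t k)%N -> tangent M (x k) w ->
  model f theta F (x k) (t_Q t k j) (t_v t k j)
    <= model f theta F (x k) (t_Q t k j) w + mu_max p / 2 * `|t_v t k j| ^+ 2.
Proof.
move=> jJ Tw; have [_ [_ opt] [_ LB] _ gap] := run_inner jJ.
have [_ /(_ k) [[_ /andP[_ mu_le]] _ _ _ _]] := run.
have : t_mu t k / 2 * `|t_v t k j| ^+ 2 <= mu_max p / 2 * `|t_v t k j| ^+ 2.
  by rewrite ler_wpM2r ?exprn_ge0// ler_wpM2r.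
by have := opt w Tw; lra.
Qed.

Lemma cluster_in_manifold xs : cluster (x @ \oo) xs -> M xs.
Proof.
move=> hxs; apply: closedM => B xsB.
have : (x @ \oo) (range x) by exists 0%N => // k _; exists k.
move=> /hxs/(_ xsB)[_ [[k _ <-] Bk]].
by exists (x k); split=> //; exact: run_in_manifold.
Qed.

(* When the accepted regularization [alpha] is unbounded along the iterates
   near [xs], the last rejected trial step is used instead of the accepted
   one. *)
Lemma run_approximate_stationarity xs : cluster (x @ \oo) xs ->
  forall e : R, 0 < e -> exists k j, let u := t_v t k j in
  [/\ (j <= t_stop t k)%N, `|xs - x k| < e, 0 < `|u|, `|u| < e
    & (alpha_bar p + t_alpha t k j) * `|u| < e].
Proof.
move=> hxs e e0; have [/andP[amin aminmax] _ abar0 gbar0 sigma1] := hp.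
have Mxs := cluster_in_manifold hxs.
have [r r0 [B hB]] := rejected_step_small hR hp Mxs e0.
have sigma0 : 0 < sigma p by apply: lt_trans sigma1.
(* An accepted value above [A] exceeds [alpha_max], so at least one trial was rejected, and exceeds
   [sigma * B], so the last rejected value is at least [B]. *)
pose A := Num.max (alpha_max p) (sigma p * B).
have amaxA : alpha_max p <= A by rewrite le_max lexx.
have A0 : 0 < A by apply: lt_le_trans amaxA; apply: lt_le_trans aminmax.
have D0 : 0 < 1 + alpha_bar p + A by rewrite !addr_gt0.
(* When the accepted value is at most [A], this tolerance bounds both |v| and its multiple by
   [alpha_bar p + alpha k]. *)
have [N hN] := run_steps_vanish (divr_gt0 e0 D0).
have re0 : 0 < Num.min r e by rewrite lt_min r0.
have [k Nk] := clusterP hxs N re0; rewrite lt_min => /andP[kr ke].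
have [Asmall|Alarge] := leP (alpha k) A.
  exists k, (t_stop t k); have := hN k Nk; rewrite ltr_pdivlMr// => hv.
  have v0 := run_step_neq0 k.
  have a0 := lt_le_trans amin (run_alpha_ge (leqnn (t_stop t k))).
  have h1 : (alpha_bar p + alpha k) * `|v k| <= (alpha_bar p + A) * `|v k|.
    by rewrite ler_pM2r// lerD2l.
  have h2 : 0 < (alpha_bar p + alpha k) * `|v k|.
    by rewrite mulr_gt0// addr_gt0.
  by split=> //; lra.
have [_ /(_ k) [[/andP[_ a0] _] _ rej _ _]] := run.
case J : (t_stop t k) => [|j]; first by move: Alarge; rewrite J; lra.
have jJ : (j < t_stop t k)%N by rewrite J.
have [nacc aS] := rej j jJ; have [[_ Qa _] _ [Tv _] desc _] := run_inner (ltnW jJ).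
have Ba : B <= t_alpha t k j.
  rewrite -(ler_pM2l sigma0) -aS -J ltW//; apply: le_lt_trans Alarge.
  by rewrite le_max lexx orbT.
have [v0 ve ave] := hB _ _ _ _ (run_in_manifold k) Tv kr Ba Qa desc nacc.
by exists k, j; split=> //; exact: ltnW.
Qed.

End Run.

(** * Passage to the limit at a cluster point *)

Let theta_continuous z e : 0 < e -> exists2 r : R, 0 < r &
  forall z', `|z - z'| < r -> `|theta z - theta z'| < e.
Proof.
move=> e0.
have [r r0 [L L0 hL]] :=
  convex_locally_lipschitz ctheta (@euclidean_finite_frame R Z) z.
have L1 : 0 < L + 1 by rewrite ltr_wpDl.
exists (Num.min r (e / (L + 1))); first by rewrite lt_min r0 divr_gt0.
move=> z'; rewrite lt_min ltr_pdivlMr// => /andP[zr ze].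
have zz : `|z - z| < r by rewrite subrr normr0.
by have := hL z z' zz zr; have := normr_ge0 (z - z'); lra.
Qed.

(** A unit-step difference instead of a directional derivative: by convexity, [s] times it bounds
    the first-order change along [s *: u] for s in [0, 1]. *)
Definition directional_bound y u : R :=
  'd fr y u + (theta (F y + 'd F y u) - theta (F y)).

(** Carries a negative value at the cluster point over to nearby iterates and directions. *)
Lemma directional_bound_semicontinuous x w : O x -> forall e : R, 0 < e ->
  exists2 r : R, 0 < r & forall y u, `|x - y| < r -> `|w - u| < r ->
    directional_bound y u <= directional_bound x w + e.
Proof.
move=> Ox e e0; have e3 : 0 < e / 3 by rewrite divr_gt0.
have [q1 q10 hq1] := theta_continuous (F x) e3.
have [q2 q20 hq2] := theta_continuous (F x + 'd F x w) e3.
have q22 : 0 < q2 / 2 by rewrite divr_gt0.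
have [r1 r10 h1] := continuously_differentiable_continuous (F_C1 Ox) q10.
have [r2 r20 h2] := continuously_differentiable_continuous (F_C1 Ox) q22.
have [r3 r30 h3] := continuously_differentiable_joint w (F_C1 Ox) q22.
have [r4 r40 h4] := continuously_differentiable_joint w (fr_C1 Ox) e3.
exists (Num.min (Num.min r1 r2) (Num.min r3 r4)).
  by rewrite !lt_min r10 r20 r30.
move=> y u; rewrite !lt_min -!andbA => /and4P[y1 y2 y3 y4] /and4P[_ _ u3 u4].
have /ltr_normlP[_ k1] := hq1 _ (h1 _ y1).
have FF : `|F x + 'd F x w - (F y + 'd F y u)| < q2.
  rewrite opprD addrACA; apply: le_lt_trans (ler_normD _ _) _.
  by have := h2 _ y2; have := h3 _ _ y3 u3; lra.
have /ltr_normlP[k2 _] := hq2 _ FF.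
have /ltr_normlP[k3 _] := h4 _ _ y4 u4.
by rewrite /directional_bound; lra.
Qed.

Lemma cluster_directional_bound_ge0 p Rt x t xs :
  retraction M Rt -> rivmpl_params_ok p -> rivmpl_run M f theta F p Rt x t ->
  cluster (x @ \oo) xs -> M xs ->
  forall w, tangent M xs w -> 0 <= directional_bound xs w.
Proof.
move=> hR hp run hxs Mxs w Tw; rewrite leNgt; apply/negP => neg.
have Oxs := MO Mxs; pose c := - directional_bound xs w.
have c0 : 0 < c by rewrite oppr_gt0.
have c2 : 0 < c / 2 by rewrite divr_gt0.
have [_ mu0 abar0 _ _] := hp.
have [r1 r10 h1] := directional_bound_semicontinuous w Oxs c2.
have [C C0 [r2 r20 h2]] := theta_lower_bound Oxs.
have m0 : 0 < Num.min r1 1 by rewrite lt_min r10 ltr01.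
have /nbhs_normP[r3 /= r30 h3] := tangent_lower_semicontinuous cM Mxs Tw m0.
(* With s = kappa |v|, the gain s c/2 equals (C + 2)|v|, while the losses add up to at most (C +
   1)|v|. *)
pose kappa := 2 * (C + 2) / c; pose W := 1 + `|w|.
have k0 : 0 < kappa by rewrite divr_gt0// mulr_gt0// addr_gt0.
have W0 : 0 < W by rewrite ltr_wpDr.
(* The last three bounds give, in order, s <= 1, an inexactness term of at most |v|/2, and a
   quadratic term at [s *: u] of at most |v|/2. *)
pose e := Num.min (Num.min r1 (Num.min r2 r3))
  (Num.min kappa^-1 (Num.min (mu_max p)^-1 (kappa ^+ 2 * W ^+ 2)^-1)).
have kW0 : 0 < kappa ^+ 2 * W ^+ 2 by rewrite mulr_gt0 ?exprn_gt0.
have e0 : 0 < e by rewrite !lt_min r10 r20 r30 !invr_gt0 k0 mu0.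
have [k [j [jJ xk v0 ve ave]]] := run_approximate_stationarity hR hp run hxs e0.
set v := t_v t k j in v0 ve ave *.
move: xk ve ave; rewrite !lt_min -!andbA => /and3P[y1 y2 /andP[y3 _]].
move=> /and5P[_ _ _ vk /andP[vmu _]] /and5P[_ _ _ _ /andP[_ ave]].
have Mk := run_in_manifold hR run k.
have [u Tu] := h3 _ y3 Mk; rewrite lt_min => /andP[ur u1].
have hb := h1 _ _ y1 ur.
have uW : `|u| <= W.
  have -> : u = w - (w - u) by rewrite opprB addrC subrK.
  by have := ler_normB w (w - u); rewrite /W; lra.
pose s := kappa * `|v|.
have s0 : 0 < s by rewrite mulr_gt0.
have s1 : s <= 1.
  by rewrite /s mulrC -ler_pdivlMr// div1r ltW.
have Tsu : tangent M (x k) (s *: u).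
  have [_ lin] := tangent_subspace cM Mk.
  by have := lin s 0 u u Tu Tu; rewrite scale0r addr0.
have opt := run_near_optimal run jJ Tsu.
have [[_ Qlo Qhi] _ _ _ _] := run_inner run jJ.
rewrite -/v !modelE in opt; set Q := t_Q t k j in Qlo Qhi opt.
set a := t_alpha t k j in Qlo Qhi ave.
have a0 : 0 < a.
  have [/andP[amin _] _ _ _ _] := hp.
  exact: lt_le_trans amin (run_alpha_ge hp run jJ).
have Qv : 0 <= inner v (Q v).
  apply: le_trans (Qlo v); rewrite innerZr -sqr_norm_inner.
  by rewrite mulr_ge0 ?exprn_ge0// ltW.
have Qsu : inner (s *: u) (Q (s *: u)) <= s ^+ 2 * ((alpha_bar p + a) * W ^+ 2).
  rewrite linearZ innerZl innerZr mulrA -expr2 ler_pM2l ?exprn_gt0//.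
  apply: le_trans (Qhi u) _; rewrite innerZr -sqr_norm_inner.
  by rewrite ler_pM2l ?addr_gt0// ler_pXn2r ?nnegrE ?(ltW W0).
have low := h2 _ y2 v.
have s01 : 0 <= s <= 1 by rewrite ltW.
have cvx := convex_line (F (x k)) ('d F (x k) u) ctheta s01.
have frZ : 'd fr (x k) (s *: u) = s * 'd fr (x k) u by rewrite linearZ.
have FZ : 'd F (x k) (s *: u) = s *: 'd F (x k) u by rewrite linearZ.
rewrite frZ FZ in opt.
(* The model at [v] is bounded below by [low] and [Qv], and at [s *: u] above by [cvx] and [Qsu];
   [opt] compares the two. *)
have main : s * (c / 2) <= C * `|v|
    + 2^-1 * (s ^+ 2 * ((alpha_bar p + a) * W ^+ 2)) + mu_max p / 2 * `|v| ^+ 2.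
  have : s * directional_bound (x k) u <= s * (- c + c / 2).
    by rewrite ler_pM2l// /c opprK.
  rewrite /directional_bound; lra.
have q1 : s ^+ 2 * ((alpha_bar p + a) * W ^+ 2) <= `|v|.
  have -> : s ^+ 2 * ((alpha_bar p + a) * W ^+ 2)
      = (kappa ^+ 2 * W ^+ 2) * ((alpha_bar p + a) * `|v|) * `|v|.
    by rewrite /s; ring.
  by rewrite ler_piMl// mulrC -ler_pdivlMr// div1r ltW.
have q2 : mu_max p * `|v| ^+ 2 <= `|v|.
  by rewrite expr2 mulrA ler_piMl// mulrC -ler_pdivlMr// div1r ltW.
have q3 : s * (c / 2) = (C + 2) * `|v|.
  by rewrite /s /kappa; field; rewrite gt_eqF.
have : C * `|v| + 2 * `|v| <= C * `|v| + 2^-1 * `|v| + 2^-1 * `|v|.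
  by move: main; rewrite q3; lra.
by lra.
Qed.

Lemma stationary_of_directional_bound xs : M xs ->
  (forall w, tangent M xs w -> 0 <= directional_bound xs w) ->
  stationary M f theta F xs.
Proof.
move=> Mxs hdb; have [T0 T_lin] := tangent_subspace cM Mxs.
(* Recentred at [F xs], so that linear forms below [P] are exactly the subgradients of [theta]
   there. *)
pose P z := theta (F xs + z) - theta (F xs).
have cP : convex_ineq P.
  move=> s y z s01; rewrite /P.
  have -> : F xs + (s *: y + (1 - s) *: z)
      = s *: (F xs + y) + (1 - s) *: (F xs + z).
    by rewrite !scalerDr addrACA -scalerDl (addrC s) subrK scale1r.
  by have := ctheta (F xs + y) (F xs + z) s01; lra.
have g_lin (a b : R) u w :
    'd fr xs (a *: u + b *: w) = a * 'd fr xs u + b * 'd fr xs w.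
  by rewrite linearD !linearZ.
have [|zeta [sub eq0]] := convex_multiplier g_lin cP _ T0 T_lin hdb.
  by rewrite /P addr0 subrr.
(* The normal vector is whatever balances the equation; its normality is the multiplier identity
   [eq0] on tangent vectors. *)
split=> //; exists zeta, (- (gradient fr xs + adjoint ('d F xs) zeta)); split.
- move=> z; have := sub (z - F xs).
  by rewrite /P (addrC (F xs)) subrK; lra.
- move=> u Tu; rewrite innerNl innerDl inner_gradient inner_adjoint eq0//.
  by rewrite oppr0.
- by rewrite subrr.
Qed.

End Rivmpl.

Theorem theorem5p1 (R : realType) (X Z : euclideanType R)
    (d : nat) (M O : set X)
    (f : X -> \bar R) (theta : Z -> R) (F : X -> Z)
    (hP : standing_assumptions d M O f theta F)
    (Rt : X -> X -> X) (hR : retraction M Rt)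
    (p : rivmpl_params R) (hp : rivmpl_params_ok p)
    (x : nat -> X) (hx : rivmpl_generated M f theta F p Rt x)
    (hb : bounded_set (range x)) :
  cluster (x @ \oo) !=set0 /\
  (forall xs, cluster (x @ \oo) xs -> stationary M f theta F xs).
Proof.
split=> [|xs hxs]; first exact: bounded_cluster.
have [t run] := hx.
have Mxs := cluster_in_manifold hP hR run hxs.
apply: (stationary_of_directional_bound hP Mxs).
exact: (cluster_directional_bound_ge0 hP hR hp run hxs Mxs).
Qed.
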